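(* (``Starfish lemma'') Let $\mathcal{R}$ be a $\mathbb{C}$-algebra that is a normal Noetherian domain, with fraction field $\mathcal{F}$. Let $(\tilde{\mathbf{x}},\tilde B)$ be a seed of rank $n$ in $\mathcal{F}$, with $\tilde{\mathbf{x}}=(x_1,\dots,x_m)$, $n\le m$, such that (1) all elements of $\tilde{\mathbf{x}}$ belong to $\mathcal{R}$; (2) the cluster variables $x_1,\dots,x_n$ in $\tilde{\mathbf{x}}$ are pairwise coprime in $\mathcal{R}$; (3) for each cluster variable $x_k$ ($1\le k\le n$), the seed mutation $\mu_k$ replaces $x_k$ with an element $x_k'$ that lies in $\mathcal{R}$ and is coprime to $x_k$. Then $\mathcal{A}(\tilde{\mathbf{x}},\tilde B)\subset\mathcal{R}$.
   Context: Two elements $r,r'\in\mathcal{R}$ are called coprime if they are not contained in the same prime ideal of height $1$. A domain is normal if it is integrally closed in its fraction field. A seed of rank $n$ in a field $\mathcal{F}\supset\mathbb{C}$ is a pair $(\tilde{\mathbf{x}},\tilde B)$ where $\tilde{\mathbf{x}}=(x_1,\dots,x_m)$ is algebraically independent over $\mathbb{C}$ with $\mathcal{F}=\mathbb{C}(x_1,\dots,x_m)$, and $\tilde B=(b_{ij})$ is an $m\times n$ integer matrix whose top $n\times n$ submatrix is skew-symmetrizable. The elements $x_1,\dots,x_n$ are the cluster variables of the seed and $x_{n+1},\dots,x_m$ are the frozen (coefficient) variables. For $1\le k\le n$, the mutation $\mu_k$ replaces $x_k$ by $x_k'\in\mathcal{F}$ defined by the exchange relation $x_kx_k'=\prod_{b_{ik}>0}x_i^{b_{ik}}+\prod_{b_{ik}<0}x_i^{-b_{ik}}$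 (other $x_i$ unchanged), and replaces $\tilde B$ by $\tilde B'=(b'_{ij})$ with $b'_{ij}=-b_{ij}$ if $i=k$ or $j=k$, and $b'_{ij}=b_{ij}+\tfrac12(|b_{ik}|b_{kj}+b_{ik}|b_{kj}|)$ otherwise. The cluster algebra $\mathcal{A}(\tilde{\mathbf{x}},\tilde B)\subset\mathcal{F}$ is the $\mathbb{C}$-subalgebra generated by the frozen variables $x_{n+1},\dots,x_m$ and all cluster variables of all seeds obtained from $(\tilde{\mathbf{x}},\tilde B)$ by finite sequences of mutations. *)

(* Defs.v *)
(* MathComp, over an arbitrary coefficient ring C; the complex numbers are
   C := K[i] for K : realType. *)
From HB Require Import structures.
From mathcomp Require Import all_boot all_order all_algebra.
From mathcomp Require Import mpoly.

Set Implicit Arguments.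
Unset Strict Implicit.
Unset Printing Implicit Defensive.

Import GRing.Theory.

Local Open Scope ring_scope.

#[short(type="idomainAlgType")]
HB.structure Definition IdomainAlgebra (C : nzRingType) :=
  {A of GRing.IntegralDomain A & GRing.Algebra C A}.

#[short(type="fieldAlgType")]
HB.structure Definition FieldAlgebra (C : nzRingType) :=
  {A of GRing.Field A & GRing.Algebra C A}.

Section CommutativeAlgebra.

(* Ideals are boolean predicates. Under the classical axioms that realType
   already relies on (mathcomp.classical.boolp), these are all the subsets. *)

Definition noetherian (R : comNzRingType) : Prop :=
  forall I : {pred R},
    0 \in I -> (forall a, {in I &, forall u v, a * u + v \in I}) ->
    exists2 s : seq R, {subset s <= I} &
      forall u, u \in I ->
        exists c : 'I_(size s) -> R, u = \sum_(i < size s) c i * s`_i.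

(* p 0 < p 1 < ... < p k = P *)
Definition prime_chain (R : comNzRingType) (P : prime_idealr R) (k : nat) : Prop :=
  exists p : nat -> prime_idealr R,
    p k =i P /\
    forall i, (i < k)%N ->
      {subset p i <= p i.+1} /\ ~ {subset p i.+1 <= p i}.

Definition has_height (R : comNzRingType) (P : prime_idealr R) (h : nat) : Prop :=
  prime_chain P h /\ forall k, prime_chain P k -> (k <= h)%N.

Definition coprime_elts (R : comNzRingType) (a b : R) : Prop :=
  forall P : prime_idealr R, has_height P 1 -> ~ (a \in P /\ b \in P).

Definition is_fraction_field (R : idomainType) (F : fieldType)
    (iota : R -> F) : Prop :=
  injective iota /\
  forall z : F, exists a b : R, b != 0 /\ z = iota a / iota b.

Definition integrally_closed_in (R F : nzRingType) (iota : R -> F) : Prop :=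
  forall z : F, integralOver iota z -> exists r : R, iota r = z.

End CommutativeAlgebra.

Section ClusterAlgebra.

Variables (C : comNzRingType) (F : fieldAlgType C) (m n : nat).
Hypothesis le_nm : (n <= m)%N.

Local Notation top := (widen_ord le_nm).

Definition eval_at (x : 'I_m -> F) (p : {mpoly C[m]}) : F :=
  mmap (in_alg F) x p.

Definition alg_independent (x : 'I_m -> F) : Prop :=
  forall p : {mpoly C[m]}, eval_at x p = 0 -> p = 0.

Definition field_generated_by (x : 'I_m -> F) : Prop :=
  forall z : F, exists p q : {mpoly C[m]},
    eval_at x q != 0 /\ z = eval_at x p / eval_at x q.

Definition skew_symmetrizable (A : 'M[int]_n) : Prop :=
  exists d : 'I_n -> int, (forall i, 0 < d i) /\
    forall i j, d i * A i j = - (d j * A j i).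

(* The cluster variables are [vars (top k)] for [k : 'I_n]; the frozen
   variables are [vars i] for [n <= i < m]. *)
Record seed_data := SeedData {
  vars : 'I_m -> F;
  exmx : 'M[int]_(m, n)
}.

Definition is_seed (s : seed_data) : Prop :=
  [/\ alg_independent (vars s), field_generated_by (vars s) &
      skew_symmetrizable (rowsub top (exmx s))].

(* In a seed [vars s (top k)] is nonzero, so this quotient is the unique
   solution x_k' of the exchange relation. *)
Definition exchanged (s : seed_data) (k : 'I_n) : F :=
  let x := vars s in let B := exmx s in
  (\prod_(i | (0 < B i k)%R) x i ^+ `|B i k|%N
   + \prod_(i | (B i k < 0)%R) x i ^+ `|B i k|%N) / x (top k).

(* The division by 2 is exact: |a| b + a |b| is always even. *)
Definition mutate_mx (B : 'M[int]_(m, n)) (k : 'I_n) : 'M[int]_(m, n) :=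
  \matrix_(i, j)
    if (i == top k) || (j == k) then - B i j
    else B i j + ((`|B i k| * B (top k) j + B i k * `|B (top k) j|)%R %/ 2)%Z.

Definition mutate (s : seed_data) (k : 'I_n) : seed_data :=
  SeedData (fun i => if i == top k then exchanged s k else vars s i)
           (mutate_mx (exmx s) k).

Definition cluster_generator (s : seed_data) (z : F) : Prop :=
  (exists2 i : 'I_m, (n <= i)%N & z = vars s i) \/
  (exists (ks : seq 'I_n) (k : 'I_n), z = vars (foldl mutate s ks) (top k)).

Definition in_cluster_algebra (s : seed_data) (z : F) : Prop :=
  forall S : {pred F}, GRing.subalg_closed S ->
    (forall g, cluster_generator s g -> g \in S) -> z \in S.

End ClusterAlgebra.

(* Main.v *)
(* Let z be a cluster variable outside R.  Since R is Noetherian and normal, the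
   conductor {r | r z in R} lies in a prime P of height 1.  By the Laurent
   phenomenon, with frozen variables not inverted, z times a power of
   x_1 ... x_n lies in R, so some x_k is in P; the same argument in the seed
   mutated at k puts x_k' or some x_l with l != k in P as well, which contradicts
   coprimality.

   The Laurent phenomenon is proved for functions on positive rational points, on
   which mutations are everywhere defined and exchange polynomials do not
   vanish; identities between such functions are transferred to F at the end,
   because the initial cluster is algebraically independent. *)
Require Import Defs.
From mathcomp Require Import all_boot all_order all_algebra.
From mathcomp Require Import reals complex.
From HB Require Import structures.
From mathcomp Require Import mpoly ring lra zify.
From Stdlib Require Import FunctionalExtensionality ClassicalEpsilon.
Set Implicit Arguments.
Unset Strict Implicit.
Unset Printing Implicit Defensive.
Import Order.TTheory GRing.Theory Num.Theory.
Local Open Scope ring_scope.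

(** * Height one primes of normal Noetherian domains *)

(** The Laurent phenomenon is obtained without factoring Laurent polynomials. A function that is
    Laurent in an adjacent seed has, in the given variables, only powers of one exchange polynomial
    [f] as new denominators. A second seed supplies a denominator [h] that is a nonzerodivisor
    modulo [f], and [f] is then removed one power at a time. Modulo [f], such an [h] is a product of
    units and of factors linear, with unit leading coefficient, in a variable absent from [f]. When
    two mutations commute, their exchange polynomials may share factors or even coincide; an extra
    frozen variable separates them and is finally set to 1.

    Frozen variables may fail to be invertible in R, so their inverses have to be eliminated:
    cluster variables stay bounded when one frozen variable tends to 0.

    Division by 0 yields 0 in a field, so mutation undoes itself only where exchange polynomials do
    not vanish; this is why positive points are used. *)

Definition pred_of (T : Type) (P : T -> Prop) : {pred T} :=
  fun x => if excluded_middle_informative (P x) then true else false.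

Lemma in_pred_of (T : Type) (P : T -> Prop) x : reflect (P x) (x \in pred_of P).
Proof.
rewrite unfold_in /pred_of.
by case: excluded_middle_informative => h; constructor.
Qed.

Section NormalNoetherian.
Variables (R : idomainType) (F : fieldType) (iota : {rmorphism R -> F}).
Hypothesis hfrac : is_fraction_field iota.
Hypothesis hnormal : integrally_closed_in iota.
Hypothesis hnoeth : noetherian R.

Local Notation isR z := (exists r : R, iota r = z).

Lemma iota_eq0 a : (iota a == 0) = (a == 0).
Proof. by rewrite -(rmorph0 iota) (inj_eq hfrac.1). Qed.

(** The elements q w^n generate an ideal of R. Finitely many of them suffice, and cancelling [q] in
    the expression of the next one gives a monic equation for [w]. *)
Lemma almost_integral (q : R) (w : F) : q != 0 ->
  (forall n, isR (iota q * w ^+ n)) -> isR w.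
Proof.
move=> q0 hq.
pose I := pred_of (fun u : R => exists n (c : nat -> R),
  iota u = \sum_(i < n) iota (c i) * (iota q * w ^+ i)).
have I0 : 0 \in I.
  by apply/in_pred_of; exists 0%N, (fun=> 0); rewrite big_ord0 rmorph0.
have widen n (c : nat -> R) u k : (n <= k)%N ->
    iota u = \sum_(i < n) iota (c i) * (iota q * w ^+ i) ->
    exists c' : nat -> R, iota u = \sum_(i < k) iota (c' i) * (iota q * w ^+ i).
  move=> nk ->; exists (fun i => if (i < n)%N then c i else 0).
  rewrite (big_ord_widen k (fun i => iota (c i) * (iota q * w ^+ i)) nk).
  rewrite big_mkcond /=; apply: eq_bigr => i _.
  by case: ifP => // _; rewrite rmorph0 mul0r.
have [|s sI hs] := hnoeth I0.
  move=> a u v /in_pred_of [n [c hc]] /in_pred_of [k [d hd]]; apply/in_pred_of.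
  have [c' hc'] := widen _ _ _ _ (leq_maxl n k) hc.
  have [d' hd'] := widen _ _ _ _ (leq_maxr n k) hd.
  exists (maxn n k), (fun i => a * c' i + d' i).
  rewrite rmorphD rmorphM hc' hd' mulr_sumr -big_split /=.
  by apply: eq_bigr => i _; rewrite rmorphD rmorphM /= mulrDl !mulrA.
(* Each generator uses finitely many powers of [w]; [N] bounds them all. *)
have [N hN] : exists N, forall u, u \in s ->
    exists c : nat -> R, iota u = \sum_(i < N) iota (c i) * (iota q * w ^+ i).
  elim: (s) (sI) => [|u t IH] sub; first by exists 0%N.
  have [|N hN] := IH; first by move=> v vt; apply: sub; rewrite inE vt orbT.
  have /in_pred_of [n [c hc]] := sub u (mem_head _ _).
  exists (maxn n N) => v; rewrite inE => /orP [/eqP ->|/hN [c' hc']].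
    exact: widen (leq_maxl _ _) hc.
  exact: widen (leq_maxr _ _) hc'.
have hspan u : u \in I ->
    exists c : nat -> R, iota u = \sum_(i < N) iota (c i) * (iota q * w ^+ i).
  move=> /hs [c ->].
  elim/big_ind: _ => [|x y [cx hx] [cy hy]|i _].
  - exists (fun=> 0); rewrite (rmorph0 iota) big1 // => i _.
    by rewrite ?(rmorph0 iota) mul0r.
  - exists (fun i => cx i + cy i).
    rewrite rmorphD hx hy -big_split /=; apply: eq_bigr => i _.
    by rewrite rmorphD mulrDl.
  - have [d hd] := hN _ (mem_nth 0 (ltn_ord i)).
    exists (fun j => c i * d j); rewrite rmorphM hd mulr_sumr.
    by apply: eq_bigr => j _; rewrite rmorphM mulrA.
have [u hu] := hq N.
have [|c hc] := hspan u.
  apply/in_pred_of; exists N.+1, (fun i => (i == N)%:R).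
  rewrite big_ord_recr /= eqxx rmorph1 mul1r hu big1 ?add0r // => i _.
  by rewrite (ltn_eqF (ltn_ord i)) rmorph0 mul0r.
apply: hnormal.
exists ('X^N - \poly_(i < N) c i).
  rewrite monicE lead_coefDl ?lead_coefXn // size_polyN size_polyXn.
  by rewrite ltnS size_poly.
rewrite /root rmorphB /= map_polyXn poly_def rmorph_sum hornerD hornerN.
rewrite hornerXn horner_sum subr_eq0; apply/eqP.
apply: (mulfI (x := iota q)); first by rewrite iota_eq0.
rewrite -hu hc mulr_sumr; apply: eq_bigr => i _ /=.
by rewrite map_polyZ map_polyXn hornerZ hornerXn mulrCA.
Qed.

(** Iterating from [q] keeps every q w^n in the ideal, so [q] is a common denominator of all powers
    of [w]. *)
Lemma ideal_mul_stable (I : {pred R}) (q : R) (w : F) : q != 0 -> q \in I ->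
  (forall r, r \in I -> exists2 t, t \in I & iota t = iota r * w) -> isR w.
Proof.
move=> q0 qI hI; apply: (almost_integral q0) => n.
suff [t _ ht] : exists2 t, t \in I & iota t = iota q * w ^+ n by exists t.
elim: n => [|n [t tI ht]]; first by exists q => //; rewrite expr0 mulr1.
have [t' t'I ht'] := hI t tI; exists t' => //.
by rewrite ht' ht exprSr mulrA.
Qed.

(** Without a maximal member, choice gives a strictly increasing sequence; its union is an ideal
    whose finitely many generators already lie in one term. *)
Lemma noetherian_maximal (T : Type) (J : T -> {pred R}) (t0 : T) :
  (forall t, 0 \in J t) ->
  (forall t a, {in J t &, forall u v, a * u + v \in J t}) ->
  exists t, forall t', {subset J t <= J t'} -> {subset J t' <= J t}.
Proof.
move=> J0 JD.
case: (excluded_middle_informative (exists t,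
  forall t', {subset J t <= J t'} -> {subset J t' <= J t})) => // hn.
have next t : {t' | {subset J t <= J t'} /\ ~ {subset J t' <= J t}}.
  apply: constructive_indefinite_description.
  case: (excluded_middle_informative
    (exists t', {subset J t <= J t'} /\ ~ {subset J t' <= J t})) => // hn'.
  case: hn; exists t => t' sub.
  case: (excluded_middle_informative {subset J t' <= J t}) => // h.
  by case: hn'; exists t'.
pose c n := iter n (fun t => sval (next t)) t0.
have cS n : {subset J (c n) <= J (c n.+1)} /\ ~ {subset J (c n.+1) <= J (c n)}.
  by rewrite /c /=; case: (next _).
have mono n k : (n <= k)%N -> {subset J (c n) <= J (c k)}.
  move=> /subnK <-; elim: (k - n)%N => // l IH x /IH.
  by rewrite addSn; apply: (cS _).1.
pose U := pred_of (fun u => exists n, u \in J (c n)).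
have U0 : 0 \in U by apply/in_pred_of; exists 0%N.
have [|s sU hs] := hnoeth U0.
  move=> a u v /in_pred_of [n un] /in_pred_of [k vk]; apply/in_pred_of.
  exists (maxn n k); apply: JD.
    exact: mono (leq_maxl _ _) _ un.
  exact: mono (leq_maxr _ _) _ vk.
have [N hN] : exists N, {subset s <= J (c N)}.
  elim: (s) (sU) => [|u t IH] sub; first by exists 0%N.
  have [|N hN] := IH; first by move=> v vt; apply: sub; rewrite inE vt orbT.
  have /in_pred_of [n hn'] := sub u (mem_head _ _).
  exists (maxn n N) => v; rewrite inE => /orP [/eqP ->|/hN].
    exact: mono (leq_maxl _ _) _ _.
  exact: mono (leq_maxr _ _) _.
case: (cS N).2 => u hu.
have [|d ->] := hs u; first by apply/in_pred_of; exists N.+1.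
elim/big_ind: _ => // [x y hx hy|i _].
  by rewrite -[x]mul1r; apply: JD.
by rewrite -[_ * _]addr0; apply: JD => //; apply/hN/mem_nth.
Qed.

(* The prime is the annihilator of the class of w in F / R, for a multiple w
   of z chosen so that this annihilator is maximal. *)
Lemma height1_conductor (z : F) : ~ isR z ->
  exists2 P : prime_idealr R, has_height P 1 &
    forall r, isR (iota r * z) -> r \in P.
Proof.
move=> hz.
pose J (t : {r : R | ~ isR (iota r * z)}) :=
  pred_of (fun r => isR (iota r * (iota (sval t) * z))).
have z1 : ~ isR (iota 1 * z) by rewrite rmorph1 mul1r.
have [||[r0 hr0] hmax] := @noetherian_maximal _ J (exist _ 1 z1).
- by move=> t; apply/in_pred_of; exists 0; rewrite rmorph0 mul0r.
- move=> t a u v /in_pred_of [x hx] /in_pred_of [y hy]; apply/in_pred_of.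
  exists (a * x + y); rewrite !rmorphD !rmorphM hx hy; ring.
pose w := iota r0 * z; have hw : ~ isR w by [].
pose I := pred_of (fun r => isR (iota r * w)).
have I0 : 0 \in I by apply/in_pred_of; exists 0; rewrite rmorph0 mul0r.
have ID a : {in I &, forall u v, a * u + v \in I}.
  move=> u v /in_pred_of [x hx] /in_pred_of [y hy]; apply/in_pred_of.
  exists (a * x + y); rewrite !rmorphD !rmorphM hx hy; ring.
have I1 : 1 \notin I.
  by apply/in_pred_of; rewrite rmorph1 mul1r.
(* If [u] is outside [I], then u r0 is again an admissible multiplier and its ideal contains [I]. By
   maximality it equals [I], and it contains [v] when u v is in [I]. *)
have Iprime : prime_idealr_closed I.
  move=> u v uvI; case: (boolP (u \in I)) => //= uI.
  have uz : ~ isR (iota (u * r0) * z).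
    move=> [x hx]; move/negP: uI; apply; apply/in_pred_of; exists x.
    by rewrite hx rmorphM mulrA.
  have sub : {subset J (exist _ (u * r0) uz) <= I}.
    apply: hmax => r /in_pred_of [x /= hx]; apply/in_pred_of; exists (u * x) => /=.
    by rewrite !rmorphM hx; ring.
  apply: sub; move/in_pred_of: uvI => [x hx]; apply/in_pred_of; exists x => /=.
  by rewrite hx /w !rmorphM; ring.
pose i1 := isIdealr.Build R I (And3 I0 I1 ID).
pose i2 := isPrimeIdealrClosed.Build R I Iprime.
pose P : prime_idealr R := HB.pack_for (prime_idealr R) (I : R -> bool) i1 i2.
have PI : P =i I by [].
have [a [b [b0 def_w]]] := hfrac.2 w.
have ib0 : iota b != 0 by rewrite iota_eq0.
have bI : b \in I.
  by apply/in_pred_of; exists a; rewrite def_w mulrCA divff // mulr1.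
(* If [w] mapped [I] into itself, it would lie in R. The element [p] found here generates the
   maximal ideal of the localization at [I]. *)
have [p [t [pI tI hpt]]] : exists p t, [/\ p \in I, t \notin I & iota t = iota p * w].
  case: (excluded_middle_informative (exists p t,
    [/\ p \in I, t \notin I & iota t = iota p * w])) => // hn.
  case: hw; apply: (ideal_mul_stable b0 bI) => r rI.
  move/in_pred_of: (rI) => [x hx]; exists x => //.
  by apply/negPn/negP => xI; apply: hn; exists r, x.
(* By r t = p x, where x = r w: [p] in [Q] would force [P] into [Q], and [p] outside [Q] makes [Q]
   stable under [w], which a nonzero [Q] cannot be. *)
have minimal (Q : prime_idealr R) :
    {subset Q <= P} -> ~ {subset P <= Q} -> forall q, q \in Q -> q = 0.
  move=> QP PQ q qQ; apply/eqP/negPn/negP => q0.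
  have tQ : t \notin Q by apply: contra tI => /QP.
  have key r x : iota x = iota r * w -> r * t = p * x.
    by move=> hx; apply: hfrac.1; rewrite !rmorphM hx hpt; ring.
  have pQ : p \notin Q.
    apply/negP => pQ; apply: PQ => r; rewrite PI => /in_pred_of [x hx].
    have : r * t \in Q by rewrite (key _ _ hx) mulrC idealMr.
    by rewrite prime_idealrM (negPf tQ) orbF.
  apply: hw; apply: (ideal_mul_stable q0 qQ) => r rQ.
  have := QP _ rQ; rewrite PI => /in_pred_of [x hx]; exists x => //.
  have : p * x \in Q by rewrite -(key _ _ hx) mulrC idealMr.
  by rewrite prime_idealrM (negPf pQ).
exists P; last first.
  move=> r [x hx]; rewrite PI; apply/in_pred_of; exists (r0 * x).
  by rewrite rmorphM hx /w; ring.
split.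
  have Z0 : idealr_closed (pred1 (0 : R)).
    split; rewrite ?inE ?oner_eq0 // => c u v.
    by rewrite !inE => /eqP -> /eqP ->; rewrite mulr0 addr0.
  have Zp : prime_idealr_closed (pred1 (0 : R)).
    by move=> u v; rewrite !inE mulf_eq0.
  pose j1 := isIdealr.Build R (pred1 (0 : R)) Z0.
  pose j2 := isPrimeIdealrClosed.Build R (pred1 (0 : R)) Zp.
  pose Z : prime_idealr R :=
    HB.pack_for (prime_idealr R) (pred1 (0 : R) : R -> bool) j1 j2.
  have ZE u : (u \in Z) = (u == 0) by [].
  exists (fun i => if i is 0%N then Z else P); split=> // -[|//] _; split.
    by move=> u; rewrite ZE => /eqP ->.
  by move=> /(_ b); rewrite ZE (negPf b0) => /(_ bI).
(* In a chain of length at least 2, the prime just below [P] is zero by [minimal], and nothing is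
   strictly below it. *)
case=> [|[|k]] // [Q [QP Qchain]].
have [s1 n1] := Qchain k.+1 (leqnn _).
have [_ n0] := Qchain k (leqnSn _).
exfalso; apply: n0 => q qQ.
suff -> : q = 0 by apply: idealr0.
apply: (minimal (Q k.+1)) => // [x /s1|sub]; first by rewrite QP.
by apply: n1 => x; rewrite QP; apply: sub.
Qed.

End NormalNoetherian.

(** * Matrix and seed mutation *)

Section Mutation.
Variable I : finType.
Implicit Types (B : I -> I -> int) (v : I -> int) (j k : I) (ks : seq I).

Definition half_sum (a b : int) : int := ((`|a| * b + a * `|b|)%R %/ 2)%Z.

(** Square over all of [I], so that iteration does not distinguish kinds of variables; the mutable
    indices are recorded by the predicate in [skew_sym]. *)
Definition mutB B k : I -> I -> int := fun i j =>
  if (i == k) || (j == k) then - B i j else B i j + half_sum (B i k) (B k j).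

Definition exch_poly (E : fieldType) v (x : I -> E) : E :=
  \prod_(i | 0 < v i) x i ^+ `|v i|%N + \prod_(i | v i < 0) x i ^+ `|v i|%N.

Definition mutX (E : fieldType) B k (x : I -> E) : I -> E :=
  fun i => if i == k then exch_poly (B^~ k) x / x k else x i.

Fixpoint run (E : fieldType) B (x : I -> E) ks : I -> E :=
  if ks is k :: ks' then run (mutB B k) (mutX B k x) ks' else x.

(** This is [a]_+ [b]_+ - [-a]_+ [-b]_+: the two summands have equal absolute values and cancel
    unless the signs agree. *)
Lemma half_sumE a b : half_sum a b =
  if (0 < a) && (0 < b) then a * b
  else if (a < 0) && (b < 0) then - (a * b) else 0.
Proof.
rewrite /half_sum.
have e c : (2 * c %/ 2)%Z = c by rewrite mulKz.
case: (ltrgt0P a) => ha; case: (ltrgt0P b) => hb /=.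
all: rewrite ?(gtr0_norm ha) ?(gtr0_norm hb) ?(ltr0_norm ha) ?(ltr0_norm hb) ?ha ?hb.
all: rewrite -[RHS]e; congr (_ %/ _)%Z; ring.
Qed.

Lemma half_sumN a b : half_sum (- a) (- b) = - half_sum a b.
Proof.
rewrite !half_sumE !oppr_gt0 !oppr_lt0 mulrNN.
by case: (ltrgt0P a); case: (ltrgt0P b); rewrite /= ?oppr0 ?opprK.
Qed.

Lemma half_sumNl a b : half_sum (- a) b = - half_sum a (- b).
Proof. by rewrite -{1}[b]opprK half_sumN. Qed.

Lemma half_sumC a b : half_sum a b = half_sum b a.
Proof. by rewrite /half_sum addrC ![_ * `|_|]mulrC. Qed.

Lemma half_sum0 a : half_sum a 0 = 0.
Proof. by rewrite half_sumE ltxx !andbF. Qed.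

Lemma half_sumM d a b : 0 < d -> d * half_sum a b = half_sum (d * a) b.
Proof.
move=> d0; rewrite !half_sumE !pmulr_rgt0 // !pmulr_rlt0 //.
case: (_ && _); first by rewrite mulrA.
by case: (_ && _); rewrite ?mulr0 // mulrN mulrA.
Qed.

Definition skew_sym (mut : pred I) (d : I -> int) B :=
  (forall i, 0 < d i) /\
  {in mut &, forall i j, d i * B i j = - (d j * B j i)}.

Lemma skew_diag (mut : pred I) (d : I -> int) B k : mut k -> skew_sym mut d B -> B k k = 0.
Proof.
move=> mk [d0 sB]; have := sB k k mk mk; have := d0 k; nia.
Qed.

(** Positive weights slide through [half_sum]; skew-symmetry in row and column [k] then makes both
    corrections the same multiple of [d k], up to sign. *)
Lemma skew_mutB (mut : pred I) (d : I -> int) B k : mut k -> skew_sym mut d B -> skew_sym mut d (mutB B k).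
Proof.
move=> mk [d0 sB]; split=> // i j mi mj; rewrite /mutB [(j == k) || _]orbC.
case: ifP => _; first by rewrite !mulrN sB.
rewrite !mulrDr (sB i j mi mj) opprD; congr (_ + _).
rewrite !half_sumM // (sB i k) // (sB j k) // half_sumNl [in RHS]half_sumNl opprK.
by rewrite -[in LHS]half_sumNl -mulrN -!half_sumM // half_sumC.
Qed.

Lemma skew_opp (mut : pred I) (d : I -> int) B : skew_sym mut d B -> skew_sym mut d (fun i j => - B i j).
Proof. by case=> d0 sB; split=> // i j mi mj; rewrite !mulrN sB. Qed.

Lemma skew_eq0 (mut : pred I) (d : I -> int) B j k : mut j -> mut k -> skew_sym mut d B ->
  B j k = 0 -> B k j = 0.
Proof.
move=> mj mk [d0 sB] h; have := sB k j mk mj; rewrite h; have := d0 k; nia.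
Qed.

Lemma mutBK B k : mutB (mutB B k) k = B.
Proof.
apply: functional_extensionality => i; apply: functional_extensionality => j.
rewrite /mutB !eqxx /= !orbT.
case: (_ || _); first by rewrite opprK.
by rewrite half_sumN addrK.
Qed.

Lemma mutB_opp B k : mutB (fun i j => - B i j) k = fun i j => - mutB B k i j.
Proof.
apply: functional_extensionality => i; apply: functional_extensionality => j.
by rewrite /mutB; case: ifP => // _; rewrite half_sumN opprD.
Qed.

(** Each mutation leaves the row and column of the other index unchanged, so the two corrections to
    an entry add up independently. *)
Lemma mutB_comm B j k : j != k -> B j k = 0 -> B k j = 0 ->
  mutB (mutB B j) k = mutB (mutB B k) j.
Proof.
move=> jk Bjk Bkj.
have kj : k != j by rewrite eq_sym.
apply: functional_extensionality => i; apply: functional_extensionality => l.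
rewrite /mutB ?eqxx ?orbT ?(negPf jk) ?(negPf kj) /= ?Bjk ?Bkj.
have h0 a : half_sum 0 a = 0 by rewrite half_sumC half_sum0.
case: (altP (i =P j)) => [ij|ij]; case: (altP (i =P k)) => [ik|ik].
- by rewrite -ij ik eqxx in jk.
all: case: (altP (l =P j)) => [lj|lj]; case: (altP (l =P k)) => [lk|lk].
all: rewrite ?ij ?lj ?ik ?lk ?eqxx ?(negPf ij) ?(negPf ik) ?(negPf lj) ?(negPf lk)
  ?(negPf jk) ?(negPf kj) //=.
all: rewrite ?Bjk ?Bkj ?oppr0 ?h0 ?half_sum0 ?addr0 ?h0 ?half_sum0 ?addr0 //.
all: by rewrite addrAC.
Qed.

Section Points.
Variable E : fieldType.
Implicit Types x : I -> E.

Lemma exch_polyN v x : exch_poly (fun i => - v i) x = exch_poly v x.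
Proof.
rewrite /exch_poly addrC; congr (_ + _).
  by apply: eq_big => [i|i _]; rewrite ?oppr_lt0 ?abszN.
by apply: eq_big => [i|i _]; rewrite ?oppr_gt0 ?abszN.
Qed.

Lemma eq_exch_poly v w x y : v =1 w -> (forall i, v i != 0 -> x i = y i) ->
  exch_poly v x = exch_poly w y.
Proof.
move=> vw xy; rewrite /exch_poly; congr (_ + _); apply: eq_big => i.
- by rewrite vw.
- by move=> vi; rewrite -vw xy // gt_eqF.
- by rewrite vw.
- by move=> vi; rewrite -vw xy // lt_eqF.
Qed.

Lemma mutX_opp B k x : mutX (fun i j => - B i j) k x = mutX B k x.
Proof.
by apply: functional_extensionality => i; rewrite /mutX exch_polyN.
Qed.

Lemma run_opp B x ks : run (fun i j => - B i j) x ks = run B x ks.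
Proof. by elim: ks B x => //= k ks IH B x; rewrite mutB_opp mutX_opp IH. Qed.

(** As B k k = 0, the exchange polynomial ignores [x k] and keeps its value. Where it vanishes, the
    new variable is 0 and [x k] is lost. *)
Lemma mutXK B k x : B k k = 0 -> x k != 0 -> exch_poly (B^~ k) x != 0 ->
  mutX (mutB B k) k (mutX B k x) = x.
Proof.
move=> Bkk xk P0; apply: functional_extensionality => i.
rewrite {1}/mutX; case: (altP (i =P k)) => [->|ik]; last first.
  by rewrite /mutX (negPf ik).
have -> : exch_poly (fun i => mutB B k i k) (mutX B k x) = exch_poly (B^~ k) x.
  rewrite -(exch_polyN (B^~ k)); apply: eq_exch_poly => l; rewrite /mutB eqxx orbT //.
  by rewrite oppr_eq0 /mutX; case: (l =P k) => // ->; rewrite Bkk eqxx.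
by rewrite /mutX eqxx invfM invrK mulrA divff // mul1r.
Qed.

Lemma mutX_comm B j k x : j != k -> B j k = 0 -> B k j = 0 ->
  mutX (mutB B j) k (mutX B j x) = mutX (mutB B k) j (mutX B k x).
Proof.
move=> jk Bjk Bkj.
have kj : k != j by rewrite eq_sym.
have aux j' k' : j' != k' -> B j' k' = 0 -> B k' j' = 0 ->
    exch_poly (fun i => mutB B j' i k') (mutX B j' x) = exch_poly (B^~ k') x.
  move=> jk' Bjk' Bkj'; apply: eq_exch_poly => i.
    rewrite /mutB [k' == j']eq_sym (negPf jk') orbF; case: eqP => [->|_].
      by rewrite Bjk' oppr0.
    by rewrite Bjk' half_sum0 addr0.
  rewrite /mutX; case: (i =P j') => // ->.
  by rewrite /mutB eqxx /= Bjk' oppr0 eqxx.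
apply: functional_extensionality => i; rewrite {1 3}/mutX !aux //.
rewrite /mutX; case: (altP (i =P j)) => [->|ij]; last by rewrite ?eqxx (negPf kj).
by rewrite (negPf jk).
Qed.

End Points.
End Mutation.

(** * Laurent polynomials as functions on positive points *)

Definition pos (I : finType) (x : I -> rat) := forall i, 0 < x i.

Section LaurentFunctions.
Variable I : finType.
Local Notation pt := (I -> rat).
Implicit Types (V T : pred I) (phi psi : pt -> rat) (x y : pt) (s : I).

(* Laurent polynomials with integer coefficients, seen as functions on positive
   points: V lists the variables allowed, T those that may be inverted. *)
Inductive laurent V T : (pt -> rat) -> Prop :=
| laurentC (c : int) : laurent V T (fun=> c%:~R)
| laurentX i : V i -> laurent V T (fun x => x i)
| laurentV i : T i -> laurent V T (fun x => (x i)^-1)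
| laurentD phi psi : laurent V T phi -> laurent V T psi ->
    laurent V T (fun x => phi x + psi x)
| laurentM phi psi : laurent V T phi -> laurent V T psi ->
    laurent V T (fun x => phi x * psi x)
| laurent_ext phi psi : laurent V T phi ->
    (forall x, pos x -> phi x = psi x) -> laurent V T psi.

(** Substitution into Laurent polynomials has two kinds of target: Laurent functions again, and
    functions whose counterpart in the field comes from R. *)
Record subring_pred (S : (pt -> rat) -> Prop) : Prop := SubringPred {
  subringC : forall c : int, S (fun=> c%:~R);
  subringD : forall phi psi, S phi -> S psi -> S (fun x => phi x + psi x);
  subringM : forall phi psi, S phi -> S psi -> S (fun x => phi x * psi x);
  subring_ext : forall phi psi, S phi ->
    (forall x, pos x -> phi x = psi x) -> S psi
}.

Lemma laurent_subring V T : subring_pred (laurent V T).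
Proof.
by split; [apply: laurentC|apply: laurentD|apply: laurentM|apply: laurent_ext].
Qed.

Section SubringTheory.
Variable S : (pt -> rat) -> Prop.
Hypothesis SS : subring_pred S.

Lemma subring1 : S (fun=> 1).
Proof. by apply: (subring_ext SS (subringC SS 1)). Qed.

Lemma subring0 : S (fun=> 0).
Proof. by apply: (subring_ext SS (subringC SS 0)). Qed.

Lemma subringN phi : S phi -> S (fun x => - phi x).
Proof.
move=> h; apply: (subring_ext SS (subringM SS (subringC SS (-1)) h)) => x _.
by rewrite mulN1r.
Qed.

Lemma subringB phi psi : S phi -> S psi -> S (fun x => phi x - psi x).
Proof. by move=> h1 h2; apply: (subringD SS h1); apply: subringN. Qed.

Lemma subringX phi n : S phi -> S (fun x => phi x ^+ n).
Proof.
move=> h; elim: n => [|n IH]; first exact: subring1.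
apply: (subring_ext SS (subringM SS h IH)) => x _; by rewrite exprS.
Qed.

Lemma subring_sum (J : Type) (r : seq J) (P : pred J) (phi : J -> pt -> rat) :
  (forall j, P j -> S (phi j)) -> S (fun x => \sum_(j <- r | P j) phi j x).
Proof.
move=> h; elim: r => [|j r IH].
  by apply: (subring_ext SS subring0) => x _; rewrite big_nil.
case: (boolP (P j)) => Pj; last first.
  by apply: (subring_ext SS IH) => x _; rewrite big_cons (negPf Pj).
by apply: (subring_ext SS (subringD SS (h _ Pj) IH)) => x _; rewrite big_cons Pj.
Qed.

Lemma subring_prod (J : Type) (r : seq J) (P : pred J) (phi : J -> pt -> rat) :
  (forall j, P j -> S (phi j)) -> S (fun x => \prod_(j <- r | P j) phi j x).
Proof.
move=> h; elim: r => [|j r IH].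
  by apply: (subring_ext SS subring1) => x _; rewrite big_nil.
case: (boolP (P j)) => Pj; last first.
  by apply: (subring_ext SS IH) => x _; rewrite big_cons (negPf Pj).
by apply: (subring_ext SS (subringM SS (h _ Pj) IH)) => x _; rewrite big_cons Pj.
Qed.

End SubringTheory.
End LaurentFunctions.

(** [h] is a common denominator of the inverted variables after substitution; sums and products
    merely add the powers of [h]. *)
Lemma laurent_comp (I J : finType) (S : ((I -> rat) -> rat) -> Prop)
    (V T : pred J) (g : (I -> rat) -> J -> rat) (h : (I -> rat) -> rat)
    (phi : (J -> rat) -> rat) :
  subring_pred S -> (forall x, pos x -> pos (g x)) -> S h ->
  (forall j, V j -> S (fun x => g x j)) ->
  (forall j, T j -> S (fun x => (g x j)^-1 * h x)) ->
  laurent V T phi -> exists n, S (fun x => phi (g x) * h x ^+ n).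
Proof.
move=> SS gpos Sh SV ST; elim=> {phi} [c|i Vi|i Ti|a b _ [n ha] _ [k hb]
  |a b _ [n ha] _ [k hb]|a b _ [n ha] hab].
- exists 0%N; apply: (subring_ext SS (subringC SS c)) => x _.
  by rewrite expr0 mulr1.
- exists 0%N; apply: (subring_ext SS (SV i Vi)) => x _.
  by rewrite expr0 mulr1.
- by exists 1%N; apply: (subring_ext SS (ST i Ti)) => x _; rewrite expr1.
- exists (n + k)%N.
  apply: (subring_ext SS (subringD SS (subringM SS ha (subringX SS k Sh))
                                      (subringM SS hb (subringX SS n Sh)))).
  by move=> x _; rewrite exprD; ring.
- exists (n + k)%N; apply: (subring_ext SS (subringM SS ha hb)) => x _.
  by rewrite exprD; ring.
- exists n; apply: (subring_ext SS ha) => x px; rewrite hab //.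
  exact: gpos.
Qed.

(** * Vanishing and growth of polynomials in one variable *)

Lemma poly_eq0_pos (p : {poly rat}) : (forall t, 0 < t -> p.[t] = 0) -> p = 0.
Proof.
move=> h; apply/eqP/negPn/negP => p0.
have := @max_poly_roots _ p [seq i.+1%:R | i <- iota 0 (size p)] p0.
rewrite size_map size_iota ltnn map_inj_uniq ?iota_uniq; last first.
  by move=> i j /eqP; rewrite eqr_nat => /eqP [].
move=> hh; suff : false by []; apply: hh => //.
apply/allP => t /mapP [i _ ->]; apply/rootP/h; by rewrite ltr0Sn.
Qed.

Lemma poly_bounded (p : {poly rat}) :
  exists2 D, 0 <= D & forall t, 0 < t -> t <= 1 -> `|p.[t]| <= D.
Proof.
exists (\sum_(i < size p) `|p`_i|); first exact: sumr_ge0.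
move=> t t0 t1; rewrite horner_coef.
apply: (le_trans (ler_norm_sum _ _ _)); apply: ler_sum => i _.
rewrite normrM ler_piMr // normrX (gtr0_norm t0).
exact: exprn_ile1 (ltW t0) t1.
Qed.

(** The bound makes the constant term vanish; dividing by ['X] lowers the exponent by one. *)
Lemma poly_low_coef0 (n : nat) (p : {poly rat}) (C : rat) :
  (forall t, 0 < t -> t <= 1 -> `|p.[t]| <= C * t ^+ n) ->
  forall i, (i < n)%N -> p`_i = 0.
Proof.
elim: n p C => // n IH p C hp.
have [q def_p] : exists q, p = p.[0]%:P + q * 'X.
  have /factor_theorem [q hq] : root (p - p.[0]%:P) 0.
    by rewrite /root !hornerE subrr.
  by exists q; rewrite -['X]subr0 -polyC0 -hq addrC subrK.
have C0 : 0 <= C by have := hp 1 ltr01 (lexx _); rewrite expr1n; have := normr_ge0 p.[1]; lra.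
have [D D0 hD] := poly_bounded q.
have p0 : p.[0] = 0.
  apply/eqP/negPn/negP => p0.
  have a0 : 0 < `|p.[0]| by rewrite normr_gt0.
  (* This [t] satisfies t <= 1 and (C + D) t < a, whereas p(0) = p(t) - t q(t) gives a <= (C + D)
     t. *)
  set a := `|p.[0]| in a0; pose t := a / (a + (C + D)).
  have s0 : 0 < a + (C + D) by lra.
  have t0 : 0 < t by rewrite divr_gt0.
  have t1 : t <= 1 by rewrite ler_pdivrMr //; lra.
  have h1 := hp t t0 t1; have h2 := hD t t0 t1.
  have e : p.[0] = p.[t] - q.[t] * t by rewrite {2}def_p !hornerE; ring.
  have : a <= (C + D) * t.
    rewrite /a e; apply: (le_trans (ler_normB _ _)).
    rewrite normrM (gtr0_norm t0) mulrDl; apply: lerD; last by rewrite ler_pM2r.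
    apply: (le_trans h1); apply: ler_wpM2l => //.
    by rewrite exprS ler_piMr ?(ltW t0) // exprn_ile1 // ltW.
  rewrite /t mulrA ler_pdivlMr //; nra.
have qb : forall t, 0 < t -> t <= 1 -> `|q.[t]| <= C * t ^+ n.
  move=> t t0 t1; have := hp t t0 t1.
  rewrite def_p p0 add0r !hornerE normrM (gtr0_norm t0) exprSr mulrA.
  by rewrite ler_pM2r.
move=> [|i] hi; rewrite def_p p0 add0r coefMX //=.
exact: IH qb _ hi.
Qed.

(** * Expansion in one variable with Laurent coefficients *)

Section Slices.
Variable I : finType.
Local Notation pt := (I -> rat).
Implicit Types (V T : pred I) (phi psi : pt -> rat) (x y : pt) (s : I).

Definition del V s : pred I := fun i => V i && (i != s).

Definition upd x s t : pt := fun i => if i == s then t else x i.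

Lemma pos_upd x s t : pos x -> 0 < t -> pos (upd x s t).
Proof. by move=> px t0 i; rewrite /upd; case: ifP. Qed.

Lemma laurent_indep V T phi : laurent V T phi -> forall x y, pos x -> pos y ->
  (forall i, V i || T i -> x i = y i) -> phi x = phi y.
Proof.
elim=> {phi} [c|i Vi|i Ti|a b _ ha _ hb|a b _ ha _ hb|a b _ ha hab] x y px py xy //.
- by apply: xy; rewrite Vi.
- by rewrite xy // Ti orbT.
- by rewrite (ha x y) // (hb x y).
- by rewrite (ha x y) // (hb x y).
- by rewrite -!hab // (ha x y).
Qed.

Lemma laurent_del_upd V T s phi x t : laurent (del V s) (del T s) phi ->
  pos x -> 0 < t -> phi (upd x s t) = phi x.
Proof.
move=> h px t0; apply: (laurent_indep h) => //; first exact: pos_upd.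
move=> i; rewrite /del /upd -andb_orl; by case/andP=> _ /negPf ->.
Qed.

Lemma laurent_sub (V V' T T' : pred I) phi : (forall i, V i -> V' i) ->
  (forall i, T i -> T' i) -> laurent V T phi -> laurent V' T' phi.
Proof.
move=> hV hT; elim=> {phi} [c|i /hV Vi|i /hT Ti|a b _ ha _ hb|a b _ ha _ hb|a b _ ha hab].
- exact: laurentC.
- exact: laurentX.
- exact: laurentV.
- exact: laurentD.
- exact: laurentM.
- exact: laurent_ext hab.
Qed.

Lemma laurent_del V T s phi : laurent (del V s) (del T s) phi -> laurent V T phi.
Proof. by apply: laurent_sub => i /andP []. Qed.

(* Polynomials in the variable s whose coefficients are Laurent polynomials in
   the other variables. *)
Definition slice V T s (p : pt -> {poly rat}) : Prop :=
  (exists d, forall x, (size (p x) <= d)%N) /\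
  forall i, laurent (del V s) (del T s) (fun x => (p x)`_i).

Lemma sliceC V T s a : laurent (del V s) (del T s) a ->
  slice V T s (fun x => (a x)%:P).
Proof.
move=> ha; split; first by exists 1%N => x; apply: size_polyC_leq1.
move=> [|i]; first by apply: laurent_ext ha _ => x _; rewrite coefC.
apply: laurent_ext (subring0 (laurent_subring _ _)) _ => x _.
by rewrite coefC.
Qed.

Lemma sliceX V T s : slice V T s (fun=> 'X).
Proof.
split; first by exists 2%N => x; rewrite size_polyX.
by move=> i; apply: laurent_ext (laurentC _ _ (i == 1%N)) _ => x _; rewrite coefX; case: eqP.
Qed.

Lemma sliceD V T s p q : slice V T s p -> slice V T s q ->
  slice V T s (fun x => p x + q x).
Proof.
move=> [[d hd] hp] [[e he] hq]; split.
  exists (maxn d e) => x; apply: (leq_trans (size_polyD _ _)).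
  by rewrite geq_max !leq_max hd he orbT.
by move=> i; apply: laurent_ext (laurentD (hp i) (hq i)) _ => x _; rewrite coefD.
Qed.

Lemma sliceM V T s p q : slice V T s p -> slice V T s q ->
  slice V T s (fun x => p x * q x).
Proof.
move=> [[d hd] hp] [[e he] hq]; split.
  exists (d + e)%N => x; apply: (leq_trans (size_polyMleq _ _)).
  by rewrite (leq_trans (leq_pred _)) // leq_add.
move=> i; have h (j : 'I_i.+1) := laurentM (hp j) (hq (i - j)%N).
apply: laurent_ext (subring_sum (laurent_subring _ _) (index_enum _)
  (P := predT) (fun j _ => h j)) _ => x _ /=.
by rewrite coefM.
Qed.

Lemma sliceXn V T s n : slice V T s (fun=> 'X^n).
Proof.
split; first by exists n.+1 => x; rewrite size_polyXn.
by move=> i; apply: laurent_ext (laurentC _ _ (i == n)) _ => x _; rewrite coefXn; case: eqP.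
Qed.

Lemma laurent_slice V T s phi : laurent V T phi -> exists n p, slice V T s p /\
  forall x, pos x -> phi x * x s ^+ n = (p x).[x s].
Proof.
elim=> {phi} [c|i Vi|i Ti|a b _ [n [p [hp ep]]] _ [k [q [hq eq]]]
  |a b _ [n [p [hp ep]]] _ [k [q [hq eq]]]|a b _ [n [p [hp ep]]] hab].
- exists 0%N, (fun=> (c%:~R)%:P); split; first exact/sliceC/laurentC.
  by move=> x _; rewrite hornerC mulr1.
- exists 0%N; case: (altP (i =P s)) => [->|is_].
    exists (fun=> 'X); split; first exact: sliceX.
    by move=> x _; rewrite hornerX mulr1.
  exists (fun x => (x i)%:P); split; last by move=> x _; rewrite hornerC mulr1.
  by apply/sliceC/laurentX; rewrite /del Vi.
- case: (altP (i =P s)) => [->|is_].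
    exists 1%N, (fun=> 1%:P); split; first exact/sliceC/(laurentC _ _ 1).
    by move=> x px; rewrite hornerC expr1 mulVf // gt_eqF.
  exists 0%N, (fun x => ((x i)^-1)%:P); split; last by move=> x _; rewrite hornerC mulr1.
  by apply/sliceC/laurentV; rewrite /del Ti.
- exists (n + k)%N, (fun x => p x * 'X^k + q x * 'X^n); split.
    by apply: sliceD; apply: sliceM => //; apply: sliceXn.
  by move=> x px; rewrite !hornerE -ep // -eq // exprD; ring.
- exists (n + k)%N, (fun x => p x * q x); split; first exact: sliceM.
  by move=> x px; rewrite hornerM -ep // -eq // exprD; ring.
- by exists n, p; split=> // x px; rewrite -hab ?ep.
Qed.

Lemma slice_upd V T s p x t : slice V T s p -> pos x -> 0 < t ->
  p (upd x s t) = p x.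
Proof. by move=> [_ h] px t0; apply/polyP => i; apply: laurent_del_upd (h i) _ _. Qed.

(** The coefficients do not see [x s], so moving [x s] alone through all positive values compares
    two fixed polynomials. *)
Lemma slice_inj V T s p q : slice V T s p -> slice V T s q ->
  (forall x, pos x -> (p x).[x s] = (q x).[x s]) ->
  forall x, pos x -> p x = q x.
Proof.
move=> hp hq h x px; apply/eqP; rewrite -subr_eq0; apply/eqP/poly_eq0_pos => t t0.
have := h _ (pos_upd s px t0); rewrite (slice_upd hp) // (slice_upd hq) //.
by rewrite {1 2}/upd eqxx !hornerE => ->; rewrite subrr.
Qed.

(* Compare coefficients of powers of x s, from the top. *)
Lemma laurent_div V T s f sigma tau phi :
  T s -> (forall i, T i -> V i) ->
  laurent (del V s) (del T s) f -> (forall x, pos x -> f x != 0) ->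
  laurent (del V s) (del T s) sigma -> (forall x, pos x -> sigma x != 0) ->
  laurent (del V s) (del T s) (fun x => (sigma x)^-1) ->
  laurent (del V s) (del T s) tau ->
  laurent V T phi ->
  laurent V T (fun x => phi x * (sigma x * x s + tau x) / f x) ->
  laurent V T (fun x => phi x / f x).
Proof.
move=> Ts TV hf f0 hs s0 hsV ht hphi hq.
have [n [p [hp ep]]] := laurent_slice s hphi.
have [k [q [hq' eq]]] := laurent_slice s hq.
have hp' : slice V T s (fun x => p x * 'X^k) by apply: sliceM => //; apply: sliceXn.
set p' := fun x => _ in hp'.
(* [p] is phi times x_s^n, and [q] is the given quotient times x_s^k; both sides are brought to the
   exponent n + k. *)
have key : forall x, pos x -> ((sigma x)%:P * 'X + (tau x)%:P) * p' x =
    (f x)%:P * (q x * 'X^n).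
  apply: (@slice_inj V T s).
  - by apply: sliceM => //; apply: sliceD; [apply: sliceM|]; do ?[exact: sliceC|exact: sliceX].
  - by apply: sliceM; [exact: sliceC|apply: sliceM => //; exact: sliceXn].
  - move=> x px; rewrite /p' !(hornerM, hornerD, hornerC, hornerX, hornerXn) -ep // -eq //; by field; apply: f0.
have [[d hd] hpc] := hp'.
(* The coefficient of degree i + 1 in [key], solved for the lower coefficient of [p']. *)
have step : forall i x, pos x -> (p' x)`_i / f x =
    (sigma x)^-1 * ((q x * 'X^n)`_i.+1 - tau x * ((p' x)`_i.+1 / f x)).
  move=> i x px; have := congr1 (fun r : {poly rat} => r`_i.+1) (key x px).
  rewrite mulrDl -mulrA coefD !coefCM [_ * p' x]mulrC coefMX /= => e.
  have hf0 := f0 x px; have hs0 := s0 x px.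
  apply: (mulIf hf0); rewrite divfK //; apply: (mulfI hs0).
  rewrite !mulrA divff // mul1r mulrBl -!mulrA mulVf // mulr1 [_ * f x]mulrC -e.
  by rewrite addrK.
(* Descending induction: the coefficients of [p'] vanish from degree [d] on. *)
have coefs i : laurent (del V s) (del T s) (fun x => (p' x)`_i / f x).
  have [l] := ubnP (d - i)%N; elim: l i => // l IH i le.
  have SS := laurent_subring (del V s) (del T s).
  case: (leqP d i) => di.
    apply: laurent_ext (subring0 SS) _ => x px.
    by rewrite nth_default ?mul0r // (leq_trans (hd x)).
  apply: laurent_ext (laurentM hsV (subringB SS _ (laurentM ht (IH i.+1 _)))) _.
  - have : slice V T s (fun x => q x * 'X^n) by apply: sliceM => //; exact: sliceXn.
    by case=> _ /(_ i.+1); apply.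
  - by lia.
  - by move=> x px /=; rewrite -step.
have SS := laurent_subring V T.
have h1 := subring_sum SS (index_enum 'I_d) (P := predT)
  (fun i _ => laurentM (laurent_del (coefs i)) (subringX SS i (laurentX T (TV s Ts)))).
have h2 := subringX SS (n + k) (laurentV V Ts).
apply: laurent_ext (laurentM h1 h2) _ => x px /=.
have xs0 : x s != 0 by rewrite gt_eqF.
have -> : \sum_(i < d) (p' x)`_i / f x * x s ^+ i = phi x * x s ^+ (n + k) / f x.
  transitivity ((p' x).[x s] / f x).
    rewrite (horner_coef_wide _ (hd x)) mulr_suml.
    by apply: eq_bigr => i _; rewrite mulrAC.
  by rewrite /p' !hornerE -ep // exprD mulrA.
by rewrite exprVn mulrAC mulfK // expf_neq0.
Qed.

(** With phi x_s^n = p(x_s), boundedness as x_s tends to 0 kills the coefficients of p below n, so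
    no negative power of x_s remains. *)
Lemma laurent_bounded V T s phi : V s -> laurent V T phi ->
  (forall x, pos x -> exists C, forall t, 0 < t -> t <= 1 -> `|phi (upd x s t)| <= C) ->
  laurent V (del T s) phi.
Proof.
move=> Vs hphi hb.
have [n [p [hp ep]]] := laurent_slice s hphi.
have [[d hd] hpc] := hp.
have low x i : pos x -> (i < n)%N -> (p x)`_i = 0.
  move=> px; have [C hC] := hb x px; apply: (@poly_low_coef0 _ _ C) => t t0 t1.
  rewrite -(slice_upd hp px t0) -[in X in _.[X]](_ : upd x s t s = t); last by rewrite /upd eqxx.
  rewrite -ep; last exact: pos_upd.
  rewrite normrM normrX {2}/upd eqxx (gtr0_norm t0).
  by rewrite ler_wpM2r ?hC // exprn_ge0 // ltW.
have SS := laurent_subring V (del T s).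
have sub a : laurent (del V s) (del T s) a -> laurent V (del T s) a.
  by apply: laurent_sub => // i /andP [].
have h1 := subring_sum SS (index_enum 'I_d) (P := predT)
  (fun i _ => laurentM (sub _ (hpc (i + n)%N)) (subringX SS i (laurentX _ Vs))).
apply: laurent_ext h1 _ => x px /=.
have xs0 : x s ^+ n != 0 by rewrite expf_neq0 // gt_eqF.
apply: (mulIf xs0); rewrite ep // (@horner_coef_wide _ (n + d)); last first.
  by rewrite (leq_trans (hd x)) // leq_addl.
rewrite big_split_ord /= [X in _ = X + _]big1 ?add0r => [|i _]; last by rewrite (low _ _ px (ltn_ord i)) mul0r.
rewrite mulr_suml; apply: eq_bigr => i _.
by rewrite addnC exprD; ring.
Qed.

End Slices.

(** * Exchange polynomials as sums of two monomials *)

Definition monomial (I : finType) (v : I -> int) (x : I -> rat) : rat :=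
  \prod_i x i ^ v i.

Definition pos_part (I : finType) (v : I -> int) i : int := if 0 < v i then v i else 0.
Definition neg_part (I : finType) (v : I -> int) i : int := if v i < 0 then - v i else 0.
Definition zero_at (I : finType) (v : I -> int) (s : I) : I -> int :=
  fun i => if i == s then 0 else v i.

Section Monomials.
Variable I : finType.
Local Notation pt := (I -> rat).
Implicit Types (V T : pred I) (v w : I -> int) (x y : pt) (s k : I) (B : I -> I -> int).

Lemma eq_monomial v w x y : (forall i, x i ^ v i = y i ^ w i) ->
  monomial v x = monomial w y.
Proof. by move=> h; apply: eq_bigr => i _. Qed.

Lemma monomial_gt0 v x : pos x -> 0 < monomial v x.
Proof. by move=> px; apply: prodr_gt0 => i _; rewrite exprz_gt0. Qed.

Lemma monomialD v w x : pos x ->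
  monomial (fun i => v i + w i) x = monomial v x * monomial w x.
Proof.
move=> px; rewrite -big_split /=; apply: eq_bigr => i _.
by rewrite expfzDr // gt_eqF.
Qed.

Lemma monomialN v x : monomial (fun i => - v i) x = (monomial v x)^-1.
Proof. by rewrite -prodfV; apply: eq_bigr => i _; rewrite invr_expz. Qed.

Lemma monomialX v x (n : nat) : monomial (fun i => n%:Z * v i) x = monomial v x ^+ n.
Proof.
by rewrite -prodrXl; apply: eq_bigr => i _; rewrite mulrC -exprz_exp.
Qed.

Lemma monomial_zero_at v s x : monomial v x = x s ^ v s * monomial (zero_at v s) x.
Proof.
rewrite /monomial (bigD1 s) //= [in RHS](bigD1 s) //= /zero_at eqxx expr0z mul1r.
by congr (_ * _); apply: eq_bigr => i /negPf ->.
Qed.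

Lemma exch_polyE v x : exch_poly v x = monomial (pos_part v) x + monomial (neg_part v) x.
Proof.
rewrite /exch_poly /monomial; congr (_ + _); rewrite big_mkcond /=; apply: eq_bigr => i _.
  by rewrite /pos_part; case: ifP => // h; rewrite exprnP gtz0_abs.
by rewrite /neg_part; case: ifP => // h; rewrite exprnP ltz0_abs.
Qed.

Lemma pos_partE v i : pos_part v i = v i + neg_part v i.
Proof. by rewrite /pos_part /neg_part; case: (ltrgt0P (v i)) => h; lia. Qed.

(** For a column [v] of an exchange matrix, the ratio [monomial v x] of the two terms is the y-hat
    variable of the seed. *)
Lemma exch_poly_factor v x : pos x ->
  exch_poly v x = monomial (neg_part v) x * (1 + monomial v x).
Proof.
move=> px; rewrite exch_polyE (@eq_monomial _ (fun i => v i + neg_part v i) _ x).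
  by rewrite monomialD //; ring.
by move=> i; rewrite pos_partE.
Qed.

Lemma exch_poly_gt0 v x : pos x -> 0 < exch_poly v x.
Proof. by move=> px; rewrite exch_polyE addr_gt0 // monomial_gt0. Qed.

Lemma pos_mutX B k x : pos x -> pos (mutX B k x).
Proof.
by move=> px i; rewrite /mutX; case: ifP => // _; rewrite divr_gt0 // exch_poly_gt0.
Qed.

Lemma laurent_monomial V T v : (forall i, v i != 0 -> V i && T i) ->
  laurent V T (monomial v).
Proof.
move=> h; apply: (subring_prod (laurent_subring V T)) => i _.
have SS := laurent_subring V T.
case: (altP (v i =P 0)) => [->|/h /andP [Vi Ti]]; first exact: subring1 SS.
case: (v i) => n; first exact: (subringX SS n (laurentX _ Vi)).
apply: laurent_ext (subringX SS n.+1 (laurentV _ Ti)) _ => x _.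
by rewrite exprVn.
Qed.

Lemma laurent_monomialV V T v : (forall i, v i != 0 -> V i && T i) ->
  laurent V T (fun x => (monomial v x)^-1).
Proof.
move=> h; apply: laurent_ext (@laurent_monomial V T (fun i => - v i) _) _.
  by move=> i; rewrite oppr_eq0; apply: h.
by move=> x _; rewrite monomialN.
Qed.

Lemma laurent_exch_poly V T v : (forall i, v i != 0 -> V i && T i) ->
  laurent V T (exch_poly v).
Proof.
move=> h; apply: laurent_ext (laurentD (@laurent_monomial V T (pos_part v) _)
   (@laurent_monomial V T (neg_part v) _)) _.
- by move=> i; rewrite /pos_part; case: ifP => // /gt_eqF hv _; rewrite h ?hv.
- by move=> i; rewrite /neg_part; case: ifP => // /lt_eqF hv _; rewrite h ?hv.
- by move=> x _; rewrite exch_polyE.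
Qed.

End Monomials.

Notation laurent_all := (laurent predT predT).

(** * Nonzerodivisors modulo a positive Laurent polynomial *)

Section Regular.
Variable I : finType.
Local Notation pt := (I -> rat).
Implicit Types (phi psi h l p : pt -> rat) (x : pt) (s : I).

Let SS := @laurent_subring I predT predT.

Variable f : pt -> rat.
Hypothesis f_gt0 : forall x, pos x -> 0 < f x.
Hypothesis f_laurent : laurent_all f.

Let f_neq0 x : pos x -> f x != 0.
Proof. by move=> px; rewrite gt_eqF ?f_gt0. Qed.

(* h is a nonzerodivisor modulo f; quotients by f make sense as functions. *)
Definition regular h := forall p, laurent_all p ->
  laurent_all (fun x => p x * h x / f x) -> laurent_all (fun x => p x / f x).

Lemma regular_ext h h' : regular h -> (forall x, pos x -> h x = h' x) -> regular h'.
Proof.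
move=> hr e p hp hq; apply: hr => //.
by apply: laurent_ext hq _ => x px; rewrite e.
Qed.

Lemma regular_unit h : laurent_all (fun x => (h x)^-1) ->
  (forall x, pos x -> h x != 0) -> regular h.
Proof.
move=> hV h0 p hp hq; apply: laurent_ext (laurentM hV hq) _ => x px.
by field; rewrite f_neq0 ?h0.
Qed.

Lemma regularM h h' : laurent_all h -> regular h -> regular h' ->
  regular (fun x => h x * h' x).
Proof.
move=> lh hr hr' p hp hq; apply: hr => //.
apply: laurent_ext (hr' _ (laurentM hp lh) _) _ => [|x _]; last by [].
by apply: laurent_ext hq _ => x _; rewrite !mulrA.
Qed.

Lemma regularX h n : laurent_all h -> regular h -> regular (fun x => h x ^+ n).
Proof.
move=> lh hr; elim: n => [|n IH].
  by move=> p hp hq; apply: laurent_ext hq _ => x _; rewrite mulr1.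
by apply: regular_ext (regularM lh hr IH) _ => x _; rewrite exprS.
Qed.

Lemma regular_add h l : laurent_all l -> regular h -> regular (fun x => h x + f x * l x).
Proof.
move=> hl hr p hp hq; apply: hr => //.
apply: laurent_ext (subringB SS hq (laurentM hp hl)) _ => x px /=.
by field; apply: f_neq0.
Qed.

Lemma regular_linear s (sigma tau : pt -> rat) :
  laurent (del predT s) (del predT s) f ->
  laurent (del predT s) (del predT s) sigma -> (forall x, pos x -> sigma x != 0) ->
  laurent (del predT s) (del predT s) (fun x => (sigma x)^-1) ->
  laurent (del predT s) (del predT s) tau ->
  regular (fun x => sigma x * x s + tau x).
Proof.
by move=> hf hs s0 hsV ht p hp hq; apply: (laurent_div _ _ hf _ hs s0 hsV ht hp hq).
Qed.

(** This stands in for coprimality of [f] and [h]: [h] times f^(a+1) phi is a multiple of [f], hence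
    so is f^(a+1) phi, and one factor [f] is removed; repeat. *)
Lemma regular_cancel h phi a : laurent_all h -> regular h ->
  laurent_all (fun x => phi x * f x ^+ a) -> laurent_all (fun x => phi x * h x) ->
  laurent_all phi.
Proof.
move=> lh hr; elim: a => [|a IH] ha hh.
  by apply: laurent_ext ha _ => x _; rewrite mulr1.
apply: IH => //; apply: laurent_ext (hr _ ha _) _.
  apply: laurent_ext (laurentM hh (subringX SS a f_laurent)) _ => x px.
  by rewrite exprS; field; apply: f_neq0.
by move=> x px; rewrite exprS; field; apply: f_neq0.
Qed.

(** Second order is required because the third mutation in [laurent_three_step] divides by [f] once,
    so the linear term survives modulo [f]. *)
Lemma expr_1D_mod2 l n : laurent_all l -> exists2 H, laurent_all H &
  forall x, (1 + f x * l x) ^+ n = 1 + n%:R * f x * l x + f x ^+ 2 * H x.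
Proof.
move=> hl; elim: n => [|n [H hH e]].
  by exists (fun=> 0) => [|x]; [exact: subring0 SS|rewrite expr0; ring].
exists (fun x => n%:R * l x ^+ 2 + H x + f x * l x * H x).
  apply: laurentD; first apply: laurentD => //.
    by apply: laurentM; [exact: (laurentC _ _ n)|exact: (subringX SS 2 hl)].
  by apply: laurentM => //; apply: laurentM.
by move=> x; rewrite exprS e -natr1; ring.
Qed.

End Regular.

(** * Laurent phenomenon *)

Section ThreeStep.
Variable I : finType.
Local Notation pt := (I -> rat).
Implicit Types (phi W : pt -> rat) (x : pt) (j k u : I) (B : I -> I -> int).

Let SS := @laurent_subring I predT predT.

Lemma laurent_exch_poly_del v s : v s = 0 ->
  laurent (del predT s) (del predT s) (@exch_poly I rat v).
Proof.
move=> vs; apply: laurent_exch_poly => i vi; rewrite /del /= andbb.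
by apply: contraNneq vi => ->; rewrite vs.
Qed.

(** The new variable is f / x_j, with f the exchange polynomial; its inverse x_j / f brings in the
    only new denominator. *)
Lemma laurent_mutX B j W : laurent_all W ->
  exists n, laurent_all (fun x => W (mutX B j x) * exch_poly (B^~ j) x ^+ n).
Proof.
apply: (laurent_comp (g := mutX B j)) => //.
- by move=> x; apply: pos_mutX.
- exact: laurent_exch_poly.
- move=> i _; rewrite /mutX; case: eqP => _; last exact: laurentX.
  by apply: laurentM; [exact: laurent_exch_poly|exact: laurentV].
move=> i _; apply: laurent_ext (_ : laurent_all (fun x =>
    if i == j then x j else (x i)^-1 * exch_poly (B^~ j) x)) _.
  case: eqP => _; first exact: laurentX.
  by apply: laurentM; [exact: laurentV|exact: laurent_exch_poly].
move=> x px; rewrite /mutX; case: eqP => // _.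
by field; rewrite !gt_eqF // exch_poly_gt0.
Qed.

(* The variable u makes the exchange polynomial of k linear in u, hence coprime
   to that of j, from which u is absent. *)
Lemma laurent_commuting B j k u W1 W2 phi :
  B j j = 0 -> u != k -> B u j = 0 -> B u k = 1 ->
  laurent_all W1 -> laurent_all W2 ->
  (forall x, pos x -> phi x = W1 (mutX B j x)) ->
  (forall x, pos x -> phi x = W2 (mutX B k x)) ->
  laurent_all phi.
Proof.
move=> Bjj uk Buj Buk hW1 hW2 e1 e2.
have [a ha] := laurent_mutX B j hW1; have [b hb] := laurent_mutX B k hW2.
set f := exch_poly (B^~ j) in ha; set g := exch_poly (B^~ k) in hb.
have f0 : forall x, pos x -> 0 < f x by move=> x; apply: exch_poly_gt0.
have hf : laurent_all f by apply: laurent_exch_poly.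
have hg : laurent_all g by apply: laurent_exch_poly.
have ru : regular f g.
  have zu v i : zero_at v u i != 0 -> del predT u i && del predT u i.
    by rewrite /zero_at /del /= andbb; case: (i =P u).
  have nu i : neg_part (B^~ k) i != 0 -> del predT u i && del predT u i.
    rewrite /del /= andbb; apply: contraNneq => ->.
    by rewrite /neg_part Buk.
  apply: regular_ext (regular_linear f0
    (s := u) (sigma := monomial (zero_at (pos_part (B^~ k)) u))
    (tau := monomial (neg_part (B^~ k))) _ _ _ _ _) _.
  - exact: laurent_exch_poly_del.
  - by apply: laurent_monomial => i; apply: zu.
  - by move=> x px; rewrite gt_eqF // monomial_gt0.
  - by apply: laurent_monomialV => i; apply: zu.
  - by apply: laurent_monomial => i; apply: nu.
  - move=> x px; rewrite /g exch_polyE (monomial_zero_at (pos_part _) u) /=.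
    by rewrite /pos_part Buk /= expr1z mulrC.
apply: (regular_cancel f0 hf (subringX SS b hg) (regularX (n := b) hg ru) (a := a)).
  by apply: laurent_ext ha _ => x px; rewrite e1.
by apply: laurent_ext hb _ => x px; rewrite e2.
Qed.

(** [th] is the ratio of the two terms in the exchange relation of [k] after mutation at [j]; it
    carries a positive power of [f]. The third formula rests on f = q (1 + Y), with Y the monomial
    of column [j]: for c = |B k j|, 1 + (1 + th)^c / Y equals (f / q + (1 + th)^c - 1) / Y. *)
Lemma mutX_expand B j k x : pos x -> B j j = 0 -> B k k = 0 -> j != k ->
  B j k < 0 -> 0 < B k j ->
  let f := exch_poly (B^~ j) x in
  let x1 := mutX B j x in let B1 := mutB B j in
  let x2 := mutX B1 k x1 in let B2 := mutB B1 k in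
  let x3 := mutX B2 j x2 in
  let v1 i := B1 i k in let v2 i := B2 i j in
  let r := monomial (zero_at (pos_part v1) j) x in
  let s := monomial (neg_part v1) x in
  let q := monomial (neg_part (B^~ j)) x in
  let th := (f / x j) ^+ `|B j k|%N * r / s in
  [/\ v2 j = 0, x2 k = s / x k * (1 + th) &
  x3 j = monomial (neg_part v2) x / monomial (B^~ j) x *
         (f / q + ((1 + th) ^+ `|B k j|%N - 1)) * (x j / f)].
Proof.
move=> px Bjj Bkk jk Bjk Bkj f x1 B1 x2 B2 x3 v1 v2 r s q th.
have kj : k != j by rewrite eq_sym.
have f0 : 0 < f by apply: exch_poly_gt0.
have x1j : x1 j = f / x j by rewrite /x1 /mutX eqxx.
have x1i i : i != j -> x1 i = x i by move=> /negPf h; rewrite /x1 /mutX h.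
have px1 : pos x1 by apply: pos_mutX.
have px2 : pos x2 by apply: pos_mutX.
have v1j : v1 j = - B j k by rewrite /v1 /B1 /mutB eqxx.
have v1k : v1 k = 0.
  rewrite /v1 /B1 /mutB (negPf kj) /= Bkk half_sumE [0 < B j k]lt_gtF // andbF.
  by rewrite [B k j < 0]lt_gtF.
have v1j0 : 0 < v1 j by rewrite v1j oppr_gt0.
have nv1j : neg_part v1 j = 0 by rewrite /neg_part lt_gtF.
have nv1k : neg_part v1 k = 0 by rewrite /neg_part v1k.
have s0 : 0 < s by apply: monomial_gt0.
have r0 : 0 < r by apply: monomial_gt0.
have B1kj : B1 k j = - B k j by rewrite /B1 /mutB eqxx orbT.
have B1jk : B1 j k = - B j k by rewrite /B1 /mutB eqxx.
have B1ij i : B1 i j = - B i j by rewrite /B1 /mutB eqxx orbT.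
have v2j : v2 j = 0.
  rewrite /v2 /B2 /mutB (negPf jk) /= B1ij Bjj oppr0 half_sumE B1jk B1kj.
  by rewrite !oppr_gt0 !oppr_lt0 [B k j < 0]lt_gtF // [0 < B j k]lt_gtF // andbF.
have v2k : v2 k = B k j by rewrite /v2 /B2 /mutB eqxx /= B1kj opprK.
have v2i i : i != k -> v2 i = - B i j - B k j * neg_part v1 i.
  move=> ik; rewrite /v2 /B2 /mutB (negPf ik) (negPf jk) /= B1ij half_sumE B1kj.
  rewrite !oppr_gt0 !oppr_lt0 Bkj [B k j < 0]lt_gtF // andbF andbT /neg_part /v1.
  by case: ifP => _; ring.
have ex2k : x2 k = s / x k * (1 + th).
  rewrite /x2 {1}/mutX eqxx (x1i k) // exch_polyE.
  rewrite (@eq_monomial _ (neg_part v1) (neg_part v1) x1 x); last first.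
    by move=> i; case: (altP (i =P j)) => [->|/x1i ->//]; rewrite nv1j !expr0z.
  rewrite (monomial_zero_at _ j) x1j.
  rewrite (@eq_monomial _ _ (zero_at (pos_part v1) j) x1 x); last first.
    by move=> i; rewrite /zero_at; case: (altP (i =P j)) => [_|/x1i ->//].
  have -> : pos_part (B1^~ k) j = `|B j k|%N by rewrite /pos_part -/(v1 j) v1j0 v1j ltz0_abs.
  rewrite -/s -/r.
  by rewrite -exprnP /th; field; rewrite !gt_eqF.
split=> //.
have x2i i : i != k -> i != j -> x2 i = x i.
  by move=> /negPf ik ij; rewrite /x2 /mutX ik x1i.
have x2j : x2 j = f / x j by rewrite /x2 {1}/mutX (negPf jk).
(* The negative part of [v2] involves neither [j] nor [k], so only the factor 1 + [monomial v2 x2]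
   sees mutated variables. *)
rewrite /x3 {1}/mutX eqxx x2j exch_poly_factor // -/v2.
rewrite (@eq_monomial _ (neg_part v2) (neg_part v2) x2 x); last first.
  move=> i; case: (altP (i =P j)) => [->|ij].
    by rewrite /neg_part v2j !expr0z.
  case: (altP (i =P k)) => [->|ik]; last by rewrite x2i.
  by rewrite /neg_part v2k [B k j < 0]lt_gtF // !expr0z.
set c := `|B k j|%N; set Y := monomial (B^~ j) x.
have Y0 : 0 < Y by apply: monomial_gt0.
have q0 : 0 < q by apply: monomial_gt0.
have ec : B k j = c by rewrite gtz0_abs.
have -> : monomial v2 x2 = (1 + th) ^+ c / Y.
  rewrite (monomial_zero_at _ k) v2k ex2k ec.
  (* The extra exponent [c] at [k] cancels - B k j, so that one formula covers all indices. *)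
  rewrite (@eq_monomial _ _ (fun i => (- B i j + - (c%:Z * neg_part v1 i))
     + (if i == k then c%:Z else 0)) x2 x); last first.
    move=> i; rewrite /zero_at; case: (altP (i =P k)) => [->|ik].
      by rewrite nv1k mulr0 oppr0 addr0 ec addNr !expr0z.
    rewrite addr0 v2i // ec; case: (altP (i =P j)) => [->|ij].
      by rewrite Bjj nv1j mulr0 oppr0 addr0 !expr0z.
    by rewrite x2i.
  rewrite !monomialD // !monomialN monomialX -/Y -/s.
  rewrite (monomial_zero_at (fun i => if i == k then _ else _) k) eqxx.
  have -> : monomial (zero_at (fun i => if i == k then c%:Z else 0) k) x = 1.
    rewrite -(expr0z (1 : rat)) /monomial big1 // => i _.
    by rewrite /zero_at; case: eqP.
  rewrite -!exprnP mulr1 exprMn exprMn exprVn.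
  by field; rewrite !gt_eqF ?exprn_gt0.
have ef : f = q * (1 + Y) by rewrite /f exch_poly_factor.
have Y1 : 0 < 1 + Y by rewrite addr_gt0.
by rewrite ef; field; rewrite !gt_eqF // px.
Qed.

(* With f the exchange polynomial of j, the variables x_k' and x_j'' created by
   the mutations k and j after j are congruent modulo f to a unit, resp. to a
   unit times x_j / q + tau with q and tau free of x_j.  As f is free of x_j too,
   both are nonzerodivisors modulo f, the only denominator allowed by mu_j. *)
Lemma laurent_three_step B j k W1 W3 phi :
  B j j = 0 -> B k k = 0 -> j != k -> B j k < 0 -> 0 < B k j ->
  laurent_all W1 -> laurent_all W3 ->
  (forall x, pos x -> phi x = W1 (mutX B j x)) ->
  (forall x, pos x -> phi x = W3 (mutX (mutB (mutB B j) k) j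
     (mutX (mutB B j) k (mutX B j x)))) ->
  laurent_all phi.
Proof.
move=> Bjj Bkk jk Bjk Bkj hW1 hW3 e1 e3.
have kj : k != j by rewrite eq_sym.
have [a ha] := laurent_mutX B j hW1.
set f := exch_poly (B^~ j) in ha.
have f0 : forall x, pos x -> 0 < f x by move=> x; apply: exch_poly_gt0.
have hf : laurent_all f by apply: laurent_exch_poly.
set B1 := mutB B j in e3; set B2 := mutB B1 k in e3.
pose x2 x := mutX B1 k (mutX B j x); pose x3 x := mutX B2 j (x2 x).
pose v1 i := B1 i k; pose v2 i := B2 i j.
pose r := monomial (zero_at (pos_part v1) j).
pose s := monomial (neg_part v1).
pose q := monomial (neg_part (B^~ j)).
(* [b] counts the factors [f] of [th] beyond the first; below, th = f l0. *)
pose c := `|B k j|%N; pose b := `|B j k|%N.-1.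
have eb : `|B j k|%N = b.+1 by rewrite /b prednK // absz_gt0 lt_eqF.
have lm v : laurent_all (@monomial I v) by apply: laurent_monomial.
have lmV v : laurent_all (fun x => (@monomial I v x)^-1) by apply: laurent_monomialV.
have lV i : laurent_all (fun x => (x i)^-1) by apply: laurentV.
have lX i : laurent_all (fun x => x i) by apply: laurentX.
pose l0 x := f x ^+ b / x j ^+ b.+1 * r x / s x.
have hl0 : laurent_all l0.
  apply: laurentM (lmV _); apply: laurentM (lm _).
  apply: laurentM; first exact: (subringX SS b hf).
  by apply: laurent_ext (subringX SS b.+1 (lV j)) _ => x _; rewrite exprVn.
have [H hH eH] := expr_1D_mod2 hf c hl0.
have expand x : pos x -> [/\ v2 j = 0, x2 x k = s x / x k * (1 + f x * l0 x) &
    x3 x j = monomial (neg_part v2) x / monomial (B^~ j) x *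
      (x j / q x + (c%:R * l0 x * x j + f x * (H x * x j)))].
  move=> px; have := mutX_expand px Bjj Bkk jk Bjk Bkj.
  have xj0 : x j != 0 by rewrite gt_eqF.
  have sx0 : s x != 0 by rewrite gt_eqF // monomial_gt0.
  have fx0 : f x != 0 by rewrite gt_eqF // f0.
  have qx0 : q x != 0 by rewrite gt_eqF // monomial_gt0.
  rewrite /= -/f -/B1 -/B2 -/v1 -/v2 -/r -/s -/q.
  have -> : (f x / x j) ^+ `|B j k| * r x / s x = f x * l0 x.
    rewrite eb /l0 expr_div_n exprS; field.
    by rewrite sx0 expf_neq0.
  move=> [h1 h2 h3]; split => //; rewrite [LHS]h3 -/c eH.
  have Yx0 : monomial (B^~ j) x != 0 by rewrite gt_eqF // monomial_gt0.
  by field; rewrite fx0 qx0 Yx0.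
(* The equation does not involve the point, so any positive point yields it. *)
have v2j : v2 j = 0.
  by have [] := expand (fun=> 1) (fun=> ltr01).
have jz (v : I -> int) : v j = 0 -> forall i, v i != 0 -> del predT j i && del predT j i.
  by move=> vj i; rewrite /del /= andbb; apply: contraNneq => ->; rewrite vj.
pose U x := monomial (neg_part v2) x / monomial (B^~ j) x.
have hU : laurent_all U by apply: laurentM.
have hUV : laurent_all (fun x => (U x)^-1).
  apply: laurent_ext (laurentM (lm (B^~ j)) (lmV (neg_part v2))) _ => x _.
  by rewrite invf_div.
(* What survives of c l0 x_j modulo [f]: if b = 0, x_j cancels and c r / s remains; otherwise [l0]
   is itself a multiple of [f]. *)
pose tau x := (b == 0%N)%:R * c%:R * r x / s x.
have v1j : 0 < v1 j by rewrite /v1 /B1 /mutB eqxx oppr_gt0.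
have [l2 hl2 el2] : exists2 l2, laurent_all l2 &
    forall x, pos x -> c%:R * l0 x * x j = tau x + f x * l2 x.
  case: (posnP b) => [b0|b_gt0].
    exists (fun=> 0); first exact: subring0 SS.
    move=> x px; have xj0 : x j != 0 by rewrite gt_eqF.
    have sx0 : s x != 0 by rewrite gt_eqF // monomial_gt0.
    by rewrite /l0 /tau b0 /= expr0 expr1; field; rewrite sx0.
  exists (fun x => c%:R * (f x ^+ b.-1 * (x j)^-1 ^+ b * r x / s x)).
    apply: laurentM; first exact: (laurentC _ _ c).
    apply: laurentM; last exact: lmV.
    apply: laurentM; last exact: lm.
    by apply: laurentM; [exact: (subringX SS b.-1 hf)|exact: (subringX SS b (lV j))].
  move=> x px; have xj0 : x j != 0 by rewrite gt_eqF.
  have sx0 : s x != 0 by rewrite gt_eqF // monomial_gt0.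
  rewrite /l0 /tau -(prednK b_gt0) /= exprVn !exprS; field.
  by rewrite sx0 xj0 expf_neq0.
have lx2 : laurent_all (fun x => x2 x k).
  apply: laurent_ext (laurentM (laurentM (lm (neg_part v1)) (lV k))
    (laurentD (subring1 SS) (laurentM hf hl0))) _ => x px.
  by have [] := expand x px.
have lx3 : laurent_all (fun x => x3 x j).
  apply: laurent_ext (laurentM hU (laurentD (laurentM (lX j) (lmV (neg_part (B^~ j))))
     (laurentD (laurentM (laurentM (laurentC _ _ c) hl0) (lX j))
               (laurentM hf (laurentM hH (lX j)))))) _ => x px.
  by have [] := expand x px.
have reg2 : regular f (fun x => x2 x k).
  have ru : regular f (fun x => s x / x k).
    apply: (regular_unit f0).
      apply: laurent_ext (laurentM (lX k) (lmV (neg_part v1))) _ => x _.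
      by rewrite invf_div.
    by move=> x px; rewrite mulf_neq0 ?invr_eq0 ?gt_eqF // monomial_gt0.
  apply: regular_ext (regular_add f0
    (laurentM (laurentM (lm (neg_part v1)) (lV k)) hl0) ru) _ => x px.
  by have [_ -> _] := expand x px; rewrite /s; ring.
have reg3 : regular f (fun x => x3 x j).
  have ru : regular f U.
    apply: (regular_unit f0) => // x px.
    by rewrite mulf_neq0 ?invr_eq0 ?gt_eqF // monomial_gt0.
  have nqj : neg_part (B^~ j) j = 0 by rewrite /neg_part Bjj.
  have rl : regular f (fun x => (q x)^-1 * x j + tau x).
    apply: (regular_linear f0).
    - exact: laurent_exch_poly_del.
    - by apply: laurent_monomialV; apply: jz.
    - by move=> x px; rewrite invr_eq0 gt_eqF // monomial_gt0.
    - apply: laurent_ext (@laurent_monomial _ _ _ (neg_part (B^~ j)) _) _.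
        exact: jz.
      by move=> x _; rewrite invrK.
    - have lc := laurentC (del predT j) (del predT j).
      apply: laurentM; last first.
        by apply: laurent_monomialV; apply: jz; rewrite /neg_part lt_gtF.
      apply: laurentM; first by apply: laurentM; [exact: (lc (nat_of_bool (b == 0%N)))|exact: (lc c)].
      by apply: laurent_monomial; apply: jz; rewrite /zero_at eqxx.
  have rl2 := regular_add f0 (laurentD hl2 (laurentM hH (lX j))) rl.
  apply: regular_ext (regularM hU ru rl2) _ => x px.
  by have [_ _ ->] := expand x px; rewrite el2 // -/(U x); ring.
(* Only the variables [k] and [j] are new in the third seed, so a power of their product clears the
   denominators of [W3]. *)
pose h x := x2 x k * x3 x j.
have lh : laurent_all h by apply: laurentM.
have rh : regular f h by apply: regularM.
have px2 x : pos x -> pos (x2 x) by move=> px; do 2!apply: pos_mutX.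
have px3 x : pos x -> pos (x3 x) by move=> px; apply/pos_mutX/px2.
have x3k x : x3 x k = x2 x k by rewrite /x3 {1}/mutX (negPf kj).
have x3i i x : i != j -> i != k -> x3 x i = x i.
  by move=> /negPf ij /negPf ik; rewrite /x3 /mutX ij /x2 /mutX ik ij.
have [n hn] : exists n, laurent_all (fun x => W3 (x3 x) * h x ^+ n).
  apply: (laurent_comp SS px3 lh _ _ hW3) => i _.
    case: (altP (i =P j)) => [->//|ij]; case: (altP (i =P k)) => [->|ik].
      by apply: laurent_ext lx2 _ => x _; rewrite x3k.
    by apply: laurent_ext (lX i) _ => x _; rewrite x3i.
  case: (altP (i =P j)) => [->|ij].
    apply: laurent_ext lx2 _ => x px; rewrite /h mulrCA mulVf ?mulr1 //.
    by rewrite gt_eqF // px3.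
  case: (altP (i =P k)) => [->|ik].
    apply: laurent_ext lx3 _ => x px; rewrite /h x3k mulKf //.
    by rewrite gt_eqF // px2.
  by apply: laurent_ext (laurentM (lV i) lh) _ => x _; rewrite x3i.
apply: (regular_cancel f0 hf (subringX SS n lh) (regularX (n := n) lh rh) (a := a)).
  by apply: laurent_ext ha _ => x px; rewrite e1.
by apply: laurent_ext hn _ => x px; rewrite e3.
Qed.

End ThreeStep.

Section Extension.
Variable I : finType.
Implicit Types (B : I -> I -> int) (k : I).

(* One more frozen variable, occurring only in the exchange relation of k. *)
Definition extend B k : option I -> option I -> int := fun a b =>
  match a, b with
  | Some i, Some j => B i j
  | None, Some j => (j == k)%:Z
  | _, None => 0
  end.

Definition extend_mut (mut : pred I) : pred (option I) := fun a => oapp mut false a.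

Definition extend_pt (E : fieldType) (x : I -> E) : option I -> E := oapp x 1.

(** The new index is not mutable, so its one-sided entry is unconstrained. *)
Lemma skew_extend mut d B k : skew_sym mut d B ->
  skew_sym (extend_mut mut) (oapp d 1) (extend B k).
Proof.
case=> d0 sB; split=> [[i|]|[i|] [j|] mi mj] //=; exact: sB.
Qed.

Lemma big_option_prod (E : fieldType) (P : pred (option I)) (F : option I -> E) (i0 : I) :
  F None = 1 -> \prod_(a | P a) F a = \prod_(i | P (Some i)) F (Some i).
Proof.
move=> F1; rewrite big_mkcond (bigD1 None) //= F1 if_same mul1r [RHS]big_mkcond /=.
rewrite (reindex_onto Some (odflt i0)) => [|[]] //=.
by apply: eq_bigl => i; rewrite eqxx.
Qed.

(** The new variable is never mutated, keeps the value 1, and so disappears from every exchange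
    relation. *)
Lemma run_extend (E : fieldType) (B : I -> I -> int) (B' : option I -> option I -> int)
    (x : I -> E) (x' : option I -> E) ks :
  (forall i j, B' (Some i) (Some j) = B i j) ->
  x' None = 1 -> (forall i, x' (Some i) = x i) ->
  forall l, run B' x' (map Some ks) (Some l) = run B x ks l.
Proof.
elim: ks B B' x x' => [|k ks IH] B B' x x' eB x1 ex l /=; first exact: ex.
apply: IH => [i j||i].
- by rewrite /mutB !eB.
- by rewrite /mutX.
rewrite /mutX (inj_eq (@Some_inj _)) ex; case: eqP => // _; congr (_ / _).
rewrite /exch_poly !(big_option_prod _ k) ?x1 ?expr1n //.
by congr (_ + _); apply: eq_big => a; rewrite eB // ex.
Qed.

Lemma laurent_extend_pt phi : @laurent (option I) predT predT phi ->
  laurent_all (fun x : I -> rat => phi (extend_pt x)).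
Proof.
move=> hphi; have SS := @laurent_subring I predT predT.
have [||||n hn] := laurent_comp SS (g := @extend_pt rat) (h := fun=> 1) _ _ _ _ hphi.
- by move=> x px [i|] /=.
- exact: subring1.
- by case=> [i|] _ /=; [exact: laurentX|exact: subring1].
- case=> [i|] _ /=.
    by apply: laurent_ext (laurentV _ _) _ => // x _; rewrite mulr1.
  by apply: laurent_ext (subring1 SS) _ => x _; rewrite invr1 mulr1.
by apply: laurent_ext hn _ => x _; rewrite expr1n mulr1.
Qed.

End Extension.

(* Induction on the length of the mutation sequence j :: k :: rest.  If
   B j k <> 0, compare the seeds mu_j and mu_j mu_k mu_j; if B j k = 0, compare
   mu_j and mu_k, which commute. *)
Theorem laurent_phenomenon n : forall (I : finType) (mut : pred I) d B ks,
  skew_sym mut d B -> all mut ks -> (size ks <= n)%N ->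
  forall l, laurent_all (fun x : I -> rat => run B x ks l).
Proof.
elim: n => [|n IH] I mut d B [|j ks] //= sB; try by move=> *; apply: laurentX.
case: ks => [|k ks] /=.
  move=> _ _ l; rewrite /mutX; case: eqP => _; last exact: laurentX.
  by apply: laurentM; [exact: laurent_exch_poly|exact: laurentV].
rewrite ltnS => /and3P [mj mk mks] szk l.
have Bjj := skew_diag mj sB; have Bkk := skew_diag mk sB.
have unmut (I' : finType) (B' : I' -> I' -> int) (i : I') (x : I' -> rat) ks' :
    B' i i = 0 -> pos x -> run (mutB B' i) (mutX B' i x) (i :: ks') = run B' x ks'.
  by move=> Bii px /=; rewrite mutBK mutXK // gt_eqF // exch_poly_gt0.
case: (altP (j =P k)) => [ejk|jk].
  subst k; apply: laurent_ext (IH _ _ _ _ _ sB mks (ltnW szk) l) _ => x px.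
  by rewrite -(unmut _ _ j).
(* Both comparison seeds have a remaining sequence one step shorter: after j, k, j, the sequence j
   :: ks undoes the last mutation. If [B] has the other sign, its opposite qualifies and has the
   same runs. *)
have three B' : skew_sym mut d B' -> B' j k < 0 ->
    laurent_all (fun x : I -> rat => run B' x [:: j, k & ks] l).
  move=> sB' neg.
  have pos' : 0 < B' k j.
    case: sB' => d0 /(_ j k mj mk); have := d0 j; have := d0 k; nia.
  have s1 := skew_mutB mj sB'; have s2 := skew_mutB mk s1; have s3 := skew_mutB mj s2.
  apply: (laurent_three_step (skew_diag mj sB') (skew_diag mk sB') jk neg pos'
    (IH _ _ _ _ (k :: ks) s1 _ _ l) (IH _ _ _ _ (j :: ks) s3 _ _ l)) => //=.
  - by rewrite mk.
  - by rewrite mj.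
  - move=> x px; rewrite -[RHS]/(run _ _ (j :: ks) l) unmut ?(skew_diag mj s2) //.
    by do 2!apply: pos_mutX.
case: (ltrgt0P (B j k)) => Bjk.
- apply: laurent_ext (three (fun i i' => - B i i') (skew_opp sB) _) _.
    by rewrite oppr_lt0.
  by move=> x _; rewrite run_opp.
- exact: three.
have Bkj := skew_eq0 mj mk sB Bjk.
(* The exchange polynomials of [j] and [k] may have a common factor; the variable [None] occurs in
   that of [k] only. *)
pose B' := extend B k; have sB' := skew_extend k sB.
have mj' : extend_mut mut (Some j) by [].
have mk' : extend_mut mut (Some k) by [].
have mks' : all (extend_mut mut) (map Some ks) by rewrite all_map.
have jk' : Some j != Some k by rewrite (inj_eq (@Some_inj _)).
pose phi (x : option I -> rat) := run B' x (map Some [:: j, k & ks]) (Some l).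
suff hphi : laurent_all phi.
  apply: laurent_ext (laurent_extend_pt hphi) _ => x _.
  exact: (@run_extend _ _ B B' x (extend_pt x) [:: j, k & ks]).
have s1 := skew_mutB mj' sB'; have s2 := skew_mutB mk' sB'.
apply: (@laurent_commuting _ B' (Some j) (Some k) None _ _ phi _ _ _ _
  (IH _ _ _ _ (map Some (k :: ks)) s1 _ _ (Some l))
  (IH _ _ _ _ (map Some (j :: ks)) s2 _ _ (Some l))) => //=.
- by rewrite (negPf jk).
- by rewrite eqxx.
- by rewrite mk.
- by rewrite size_map.
- by rewrite mj.
- by rewrite size_map.
- move=> x px; rewrite /phi /= -/B' (mutB_comm jk' Bjk Bkj).
  by rewrite (mutX_comm x jk' Bjk Bkj).
Qed.

(** * Eliminating the inverses of frozen variables *)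

Section FrozenVariables.
Variables (I : finType) (mut : pred I).
Implicit Types (x : I -> rat) (B : I -> I -> int).

(** Here t is the value given to one frozen variable. Upper bounds alone do not survive the division
    in an exchange relation, hence the companion [bounded_away]. *)
Definition bounded (phi : rat -> rat) := exists C, forall t, 0 < t -> t <= 1 ->
  0 <= phi t <= C.
Definition bounded_away (phi : rat -> rat) := exists2 c, 0 < c & forall t,
  0 < t -> t <= 1 -> c <= phi t.

Lemma bounded_prod (J : finType) (P : pred J) (phi : J -> rat -> rat) :
  (forall j, P j -> bounded (phi j)) -> bounded (fun t => \prod_(j | P j) phi j t).
Proof.
move=> h; suff [C hC] : exists C : J -> rat, forall j, P j -> forall t, 0 < t -> t <= 1 ->
    0 <= phi j t <= C j.
  exists (\prod_(j | P j) C j) => t t0 t1; apply/andP; split.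
    by apply: prodr_ge0 => j Pj; have /andP [] := hC j Pj t t0 t1.
  by apply: ler_prod => j Pj; apply: hC.
have h' j : {C | P j -> forall t, 0 < t -> t <= 1 -> 0 <= phi j t <= C}.
  apply: constructive_indefinite_description.
  by case: (boolP (P j)) => [/h [C]|_]; [exists C|exists 0].
by exists (fun j => sval (h' j)) => j; apply: svalP (h' j).
Qed.

Lemma bounded_away_prod (J : finType) (P : pred J) (phi : J -> rat -> rat) :
  (forall j, P j -> bounded_away (phi j)) ->
  bounded_away (fun t => \prod_(j | P j) phi j t).
Proof.
move=> h; suff [C hC] : exists C : J -> rat, forall j, P j -> 0 < C j /\
    forall t, 0 < t -> t <= 1 -> C j <= phi j t.
  exists (\prod_(j | P j) C j) => [|t t0 t1].
    by apply: prodr_gt0 => j /hC [].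
  by apply: ler_prod => j /hC [c0 hc]; rewrite ltW //= hc.
have h' j : {c | P j -> 0 < c /\ forall t, 0 < t -> t <= 1 -> c <= phi j t}.
  apply: constructive_indefinite_description.
  by case: (boolP (P j)) => [/h [c c0 hc]|_]; [exists c|exists 1].
by exists (fun j => sval (h' j)) => j; apply: svalP (h' j).
Qed.

Lemma boundedX phi n : bounded phi -> bounded (fun t => phi t ^+ n).
Proof.
case=> C hC; exists (C ^+ n) => t t0 t1; have /andP [h0 h1] := hC t t0 t1.
by rewrite exprn_ge0 //= lerXn2r // nnegrE // (le_trans h0).
Qed.

Lemma bounded_awayX phi n : bounded_away phi -> bounded_away (fun t => phi t ^+ n).
Proof.
case=> c c0 hc; exists (c ^+ n) => [|t t0 t1]; first exact: exprn_gt0.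
have h := hc t t0 t1.
by rewrite lerXn2r // nnegrE ltW // (lt_le_trans c0).
Qed.

(* No cancellation occurs in an exchange relation, and x s divides at most one
   of its two terms. *)
Lemma run_bounded s B (g : rat -> I -> rat) ks : all (fun k => k != s) ks ->
  (forall i, bounded (g^~ i)) -> (forall i, i != s -> bounded_away (g^~ i)) ->
  forall i, bounded (fun t => run B (g t) ks i).
Proof.
elim: ks B g => //= k ks IH B g /andP [ks' mks] hb ha; apply: IH => //.
all: have hbp (P : pred I) (e : I -> nat) : bounded (fun t => \prod_(i | P i) g t i ^+ e i)
  by apply: bounded_prod => i _; apply: boundedX (hb i).
all: have hap (P : pred I) (e : I -> nat) : (forall i, P i -> i != s) ->
    bounded_away (fun t => \prod_(i | P i) g t i ^+ e i)
  by move=> hP; apply: bounded_away_prod => i Pi; apply/bounded_awayX/ha/hP.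
all: pose a t := \prod_(i | 0 < B i k) g t i ^+ `|B i k|%N.
all: pose b t := \prod_(i | B i k < 0) g t i ^+ `|B i k|%N.
all: have [Ca hCa] : bounded a by apply: hbp.
all: have [Cb hCb] : bounded b by apply: hbp.
all: have [ck ck0 hck] := ha k ks'.
  move=> i; rewrite /mutX; case: (altP (i =P k)) => [_|ik] //.
  exists ((Ca + Cb) / ck) => t t0 t1; rewrite /exch_poly -/(a t) -/(b t).
  have /andP [a0 a1] := hCa t t0 t1; have /andP [b0 b1] := hCb t t0 t1.
  have gk := hck t t0 t1; have gk0 := lt_le_trans ck0 gk.
  have num : 0 <= a t + b t by rewrite addr_ge0.
  apply/andP; split; first by rewrite divr_ge0 // ltW.
  apply: ler_pM => //; first by rewrite invr_ge0 ltW.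
    exact: lerD.
  by rewrite lef_pV2.
move=> i is_; rewrite /mutX; case: (altP (i =P k)) => [_|ik]; last exact: ha.
have [Ck hCk] := hb k.
have Ck0 : 0 < Ck.
  have /andP [_ h] := hCk 1 ltr01 (lexx _); have h' := hck 1 ltr01 (lexx _).
  exact: lt_le_trans (lt_le_trans ck0 h') h.
have [c c0 hc] : bounded_away (fun t => a t + b t).
  case: (ltP 0 (B s k)) => Bsk.
    have [c c0 hc] : bounded_away b.
      by apply: hap => l; apply: contraTneq => ->; rewrite -leNgt ltW.
    exists c => // t t0 t1; have /andP [a0 _] := hCa t t0 t1.
    by rewrite (le_trans (hc t t0 t1)) // lerDr.
  have [c c0 hc] : bounded_away a.
    by apply: hap => l; apply: contraTneq => ->; rewrite -leNgt.
  exists c => // t t0 t1; have /andP [b0 _] := hCb t t0 t1.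
  by rewrite (le_trans (hc t t0 t1)) // lerDl.
exists (c / Ck) => [|t t0 t1]; first exact: divr_gt0.
have /andP [_ gC] := hCk t t0 t1; have gk := hck t t0 t1.
have gk0 := lt_le_trans ck0 gk.
rewrite /exch_poly -/(a t) -/(b t).
apply: ler_pM; rewrite ?invr_ge0 ?(ltW c0) ?(ltW Ck0) //; first exact: hc.
by rewrite lef_pV2.
Qed.

(** Frozen variables are struck from the invertible ones one at a time: [run_bounded] along the line
    where only x_s varies feeds [laurent_bounded]. *)
Theorem laurent_phenomenon_frozen d B ks l :
  skew_sym mut d B -> all mut ks -> laurent predT mut (fun x => run B x ks l).
Proof.
move=> sB mks; set phi := fun x => _.
have del_frozen s T : ~~ mut s -> laurent predT T phi -> laurent predT (del T s) phi.
  move=> ns h; apply: laurent_bounded => // x px.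
  have hks : all (fun k => k != s) ks.
    by apply: sub_all mks => k mk; apply: contraNneq ns => <-.
  have [||C hC] := @run_bounded s B (upd x s) ks hks _ _ l.
  - move=> i; rewrite /upd; case: (i =P s) => _.
      by exists 1 => t t0 t1; rewrite ltW.
    by exists (x i) => t t0 t1; rewrite lexx ltW.
  - by move=> i /negPf is_; rewrite /upd is_; exists (x i).
  by exists C => t t0 t1; have /andP [h0 h1] := hC t t0 t1; rewrite ger0_norm.
have {}del_frozen (r : seq I) : laurent predT (fun i => mut i || (i \notin r)) phi.
  elim: r => [|s r IH].
    apply: laurent_sub (laurent_phenomenon sB mks (leqnn _) l) => // i _.
    by rewrite orbT.
  case: (boolP (mut s)) => ms.
    apply: laurent_sub IH => // i; rewrite inE.
    by case: (altP (i =P s)) => [->|]; rewrite ?ms.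
  apply: laurent_sub (del_frozen s _ ms IH) => // i.
  by rewrite /del inE negb_or => /andP [/orP [->//|->] ->]; rewrite orbT.
apply: laurent_sub (del_frozen (enum I)) => // i.
by rewrite mem_enum orbF.
Qed.

End FrozenVariables.

(** * From positive points to the field *)

Lemma digits_inj (D n : nat) (a b : 'I_n -> nat) :
  (forall i, (a i < D)%N) -> (forall i, (b i < D)%N) ->
  (\sum_i a i * D ^ i)%N = (\sum_i b i * D ^ i)%N -> a =1 b.
Proof.
elim: n a b => [|n IH] a b ha hb; first by move=> _ [].
have split_off (c : 'I_n.+1 -> nat) : (\sum_i c i * D ^ i =
    (\sum_(i < n) c (lift ord0 i) * D ^ i) * D + c ord0)%N.
  rewrite big_ord_recl /= expn0 muln1 addnC big_distrl /=; congr (_ + _)%N.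
  by apply: eq_bigr => i _; rewrite /bump /= add1n expnSr mulnA.
have D0 : (0 < D)%N := leq_ltn_trans (leq0n _) (ha ord0).
rewrite !split_off => e i.
have e0 : a ord0 = b ord0.
  by have := congr1 (modn^~ D) e; rewrite !modnMDl !modn_small.
have e1 := congr1 (divn^~ D) e.
rewrite /= !divnMDl // !divn_small // !addn0 in e1.
by case: (unliftP ord0 i) => [j ->|->] //; apply: IH e1 j.
Qed.

(** Put x_i = t^(D^i) with D above every exponent: distinct monomials become distinct powers of t,
    and t > 0 gives positive points. *)
Lemma mpoly_eq0_pos (m : nat) (p : {mpoly int[m]}) :
  (forall x : 'I_m -> rat, pos x -> mmap (intmul 1) x p = 0) -> p = 0.
Proof.
move=> hp; apply/eqP; rewrite -msupp_eq0; case def_s: (msupp p) => [//|m0 s].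
have m0p : m0 \in msupp p by rewrite def_s mem_head.
pose D := msize p; pose kappa (u : 'X_{1.. m}) := (\sum_i u i * D ^ i)%N.
(* Kronecker substitution *)
pose q : {poly rat} := \sum_(u <- msupp p) (p@_u)%:~R *: 'X^(kappa u).
have q0 : q = 0.
  apply: poly_eq0_pos => t t0.
  rewrite -(hp (fun i => t ^+ (D ^ i))); last by move=> i; apply: exprn_gt0.
  rewrite /q horner_sum /mmap; apply: eq_bigr => u _.
  rewrite hornerZ hornerXn /mmap1 /kappa -prodrXr; congr (_ * _).
  by apply: eq_bigr => i _; rewrite -exprM mulnC.
have digit (u : 'X_{1.. m}) i : u \in msupp p -> (u i < D)%N.
  move=> /msize_mdeg_lt; apply: leq_ltn_trans.
  by rewrite mdegE (bigD1 i) //= leq_addr.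
have := congr1 (fun r : {poly rat} => r`_(kappa m0)) q0.
rewrite coef0 /q coef_sum (bigD1_seq m0) ?msupp_uniq //= coefZ coefXn eqxx mulr1.
rewrite big1_seq ?addr0 => [/eqP|u /andP [um0 up]].
  by rewrite intr_eq0 mcoeff_eq0 m0p.
rewrite coefZ coefXn; case: eqP => [e|_]; last by rewrite mulr0.
case/eqP: um0; apply/mnmP; apply: (@digits_inj D) => // i; exact: digit.
Qed.

Section Transfer.
Variables (m : nat) (F : fieldType) (x0 : 'I_m -> F).
Hypothesis x0_free : forall p : {mpoly int[m]}, mmap (intmul 1) x0 p = 0 -> p = 0.

Local Notation pt := ('I_m -> rat).
Local Notation ev x p := (mmap (intmul 1) x p).
Implicit Types (phi psi : pt -> rat) (e : F).

(* phi and e are the values, at positive points and at x0, of the same quotient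
   of polynomials. *)
Definition realizes phi e : Prop := exists p q : {mpoly int[m]},
  [/\ forall x, pos x -> ev x q != 0 /\ phi x = ev x p / ev x q,
      ev x0 q != 0 & e = ev x0 p / ev x0 q].

Lemma realizesX i : realizes (fun x => x i) (x0 i).
Proof.
exists 'X_i, 1; split=> [x _||]; rewrite ?rmorph1 ?oner_eq0 // mmapX mmap1U divr1 //.
Qed.

Lemma realizesC (c : int) : realizes (fun=> c%:~R) c%:~R.
Proof.
exists c%:MP, 1; split=> [x _||]; rewrite ?rmorph1 ?oner_eq0 // mmapC divr1 //.
Qed.

Lemma realizesD phi psi e e' : realizes phi e -> realizes psi e' ->
  realizes (fun x => phi x + psi x) (e + e').
Proof.
move=> [p [q [h1 h2 ->]]] [p' [q' [h1' h2' ->]]].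
exists (p * q' + p' * q), (q * q'); split=> [x px||]; last 1 first.
- by rewrite !(rmorphD, rmorphM) /=; field; rewrite h2 h2'.
- have [hq ->] := h1 x px; have [hq' ->] := h1' x px.
  by rewrite !(rmorphD, rmorphM) /= mulf_neq0 //; split=> //; field; rewrite hq hq'.
- by rewrite rmorphM mulf_neq0.
Qed.

Lemma realizesM phi psi e e' : realizes phi e -> realizes psi e' ->
  realizes (fun x => phi x * psi x) (e * e').
Proof.
move=> [p [q [h1 h2 ->]]] [p' [q' [h1' h2' ->]]].
exists (p * p'), (q * q'); split=> [x px||]; last 1 first.
- by rewrite !rmorphM /=; field; rewrite h2 h2'.
- have [hq ->] := h1 x px; have [hq' ->] := h1' x px.
  by rewrite !rmorphM /= mulf_neq0 //; split=> //; field; rewrite hq hq'.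
- by rewrite rmorphM mulf_neq0.
Qed.

(** The numerator is nonzero at the point with all coordinates 1, hence a nonzero polynomial, hence
    nonzero at [x0] by [x0_free]. This legitimates the divisions in the field. *)
Lemma realizesV phi e : (forall x, pos x -> phi x != 0) -> realizes phi e ->
  realizes (fun x => (phi x)^-1) e^-1.
Proof.
move=> h0 [p [q [h1 h2 ->]]].
have p1 x : pos x -> ev x p != 0.
  move=> px; have := h0 x px; have [_ ->] := h1 x px.
  by apply: contraNneq => ->; rewrite mul0r.
exists q, p; split=> [x px||]; last by rewrite invf_div.
- by split; [apply: p1|have [_ ->] := h1 x px; rewrite invf_div].
- apply: contra_neq (p1 (fun=> 1) (fun=> ltr01)) => /x0_free ->.
  exact: rmorph0.
Qed.

Lemma realizes_ext phi psi e : realizes phi e ->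
  (forall x, pos x -> phi x = psi x) -> realizes psi e.
Proof.
move=> [p [q [h1 h2 h3]]] h; exists p, q; split=> // x px.
by have [hq e1] := h1 x px; rewrite -h.
Qed.

Lemma realizesXn phi e n : realizes phi e -> realizes (fun x => phi x ^+ n) (e ^+ n).
Proof.
move=> h; elim: n => [|n IH]; first exact: (realizesC 1).
by rewrite exprS; apply: realizes_ext (realizesM h IH) _ => x _; rewrite exprS.
Qed.

Lemma realizes_prod (J : Type) (r : seq J) (P : pred J) (phi : J -> pt -> rat) (e : J -> F) :
  (forall j, P j -> realizes (phi j) (e j)) ->
  realizes (fun x => \prod_(j <- r | P j) phi j x) (\prod_(j <- r | P j) e j).
Proof.
move=> h; elim: r => [|j r IH].
  by rewrite big_nil; apply: realizes_ext (realizesC 1) _ => x _; rewrite big_nil.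
rewrite big_cons; case: (boolP (P j)) => Pj; last first.
  by apply: realizes_ext IH _ => x _; rewrite big_cons (negPf Pj).
by apply: realizes_ext (realizesM (h _ Pj) IH) _ => x _; rewrite big_cons Pj.
Qed.

(** Cross-multiplied, the equality at positive points is an identity of polynomials, which can be
    evaluated at [x0]. *)
Lemma realizes_fun phi psi e e' : realizes phi e -> realizes psi e' ->
  (forall x, pos x -> phi x = psi x) -> e = e'.
Proof.
move=> [p [q [h1 h2 ->]]] [p' [q' [h1' h2' ->]]] h.
apply/eqP; rewrite eqr_div //; apply/eqP.
have : p * q' - p' * q = 0.
  apply: mpoly_eq0_pos => x px.
  have [hq e1] := h1 x px; have [hq' e2] := h1' x px.
  have /eqP := h x px; rewrite e1 e2 eqr_div // => /eqP e3.
  by rewrite rmorphB !rmorphM /= e3 subrr.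
by move=> /(congr1 (mmap (intmul 1) x0)) /eqP; rewrite rmorphB !rmorphM rmorph0 subr_eq0 => /eqP.
Qed.

Lemma realizes_mutX (g : pt -> 'I_m -> rat) (e : 'I_m -> F) B k :
  (forall x, pos x -> pos (g x)) -> (forall i, realizes (g^~ i) (e i)) ->
  forall i, realizes (fun x => mutX B k (g x) i) (mutX B k e i).
Proof.
move=> gpos hg i; rewrite /mutX; case: eqP => // _; apply: realizesM.
  by apply: realizesD; apply: realizes_prod => j _; apply: realizesXn.
by apply: realizesV (hg k) => x px; rewrite gt_eqF // gpos.
Qed.

Lemma realizes_run ks (g : pt -> 'I_m -> rat) (e : 'I_m -> F) B :
  (forall x, pos x -> pos (g x)) -> (forall i, realizes (g^~ i) (e i)) ->
  forall i, realizes (fun x => run B (g x) ks i) (run B e ks i).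
Proof.
elim: ks g e B => [|k ks IH] g e B gpos hg //=.
apply: (IH (fun x => mutX B k (g x))); last exact: realizes_mutX.
by move=> x px; apply/pos_mutX/gpos.
Qed.

(** [laurent_comp], with target the functions realized by elements of R. The cluster [g] is a
    parameter because both the initial cluster and its mutation at k are used. *)
Lemma laurent_denominator (R : comNzRingType) (iota : {rmorphism R -> F})
    (mut : pred 'I_m) (g : pt -> 'I_m -> rat) (gR : 'I_m -> R) (W phi : pt -> rat) e :
  laurent predT mut W -> (forall x, pos x -> pos (g x)) ->
  (forall i, realizes (g^~ i) (iota (gR i))) ->
  realizes phi e -> (forall x, pos x -> W (g x) = phi x) ->
  exists n r, e * iota (\prod_(i | mut i) gR i) ^+ n = iota r.
Proof.
move=> hW gpos hg he eW.
pose S psi := exists r, realizes psi (iota r).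
have SS : subring_pred S.
  split.
  - by move=> c; exists c%:~R; rewrite rmorph_int; apply: realizesC.
  - by move=> a b [r hr] [r' hr']; exists (r + r'); rewrite rmorphD; apply: realizesD.
  - by move=> a b [r hr] [r' hr']; exists (r * r'); rewrite rmorphM; apply: realizesM.
  - by move=> a b [r hr] hab; exists r; apply: realizes_ext hab.
pose h x := \prod_(i | mut i) g x i.
have hh : realizes h (iota (\prod_(i | mut i) gR i)).
  by rewrite rmorph_prod; apply: realizes_prod => i _.
have [|i _|i mi|n [r hr]] := laurent_comp SS gpos (h := h) _ _ _ hW.
- by exists (\prod_(i | mut i) gR i).
- by exists (gR i).
- exists (\prod_(j | mut j && (j != i)) gR j).
  rewrite rmorph_prod; apply: realizes_ext (realizes_prod _ _) _.
    by move=> j _; apply: hg.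
  move=> x px; rewrite /h [in RHS](bigD1 i) //= mulKf // gt_eqF //.
  exact: gpos.
exists n, r; apply: realizes_fun (realizesM he (realizesXn n hh)) hr _ => x px.
by rewrite /= eW.
Qed.

End Transfer.

(** * Starfish lemma *)

Lemma prime_ideal_prod (R : comNzRingType) (P : prime_idealr R) (J : finType)
    (Q : pred J) (a : J -> R) n :
  (\prod_(j | Q j) a j) ^+ n \in P -> exists2 j, Q j & a j \in P.
Proof.
elim: n => [|n IH]; first by rewrite idealr1.
rewrite exprS prime_idealrM => /orP [|/IH //].
elim/big_rec: _ => [|j x Qj IHx]; first by rewrite idealr1.
by rewrite prime_idealrM => /orP [aP|/IHx //]; exists j.
Qed.

Section ClusterSeeds.
Variables (C : comNzRingType) (F : fieldAlgType C) (m n : nat).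
Hypothesis le_nm : (n <= m)%N.
Local Notation top := (widen_ord le_nm).
Implicit Types (s : seed_data F m n).

Definition mutable : pred 'I_m := fun i => (i < n)%N.

Definition square_mx s : 'I_m -> 'I_m -> int := fun i j =>
  if insub (val j) : option 'I_n is Some j' then exmx s i j' else 0.

Definition agree (B : 'I_m -> 'I_m -> int) s := forall i j, B i (top j) = exmx s i j.

Lemma insub_top (j : 'I_n) : insub (val (top j)) = Some j.
Proof. by rewrite /= valK. Qed.

Lemma agree_square_mx s : agree (square_mx s) s.
Proof. by move=> i j; rewrite /square_mx insub_top. Qed.

Lemma top_inj : injective top.
Proof. by move=> i j /(congr1 val) /= /val_inj. Qed.

Lemma mutableP i : reflect (exists j, i = top j) (mutable i).
Proof.
apply: (iffP idP) => [mi|[j ->]]; last exact: (ltn_ord j).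
by exists (Ordinal mi); apply: val_inj.
Qed.

Lemma agree_mutate B s k : agree B s -> agree (mutB B (top k)) (mutate le_nm s k).
Proof.
by move=> h i j; rewrite mxE /mutB !h (inj_eq top_inj).
Qed.

Lemma vars_mutate B s k : agree B s ->
  vars (mutate le_nm s k) = mutX B (top k) (vars s).
Proof.
move=> h; apply: functional_extensionality => i; rewrite /mutX /=.
case: eqP => // _; rewrite /exchanged /exch_poly.
by congr ((_ + _) / _); apply: eq_big => l; rewrite h.
Qed.

Lemma vars_foldl B s ks : agree B s ->
  vars (foldl (mutate le_nm) s ks) = run B (vars s) (map top ks).
Proof.
elim: ks B s => [|k ks IH] B s h //=.
by rewrite (IH _ _ (agree_mutate k h)) (vars_mutate k h).
Qed.

Lemma skew_square_mx s : skew_symmetrizable (rowsub top (exmx s)) ->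
  exists d, skew_sym mutable d (square_mx s).
Proof.
case=> d [d0 sB].
exists (fun i => if insub (val i) : option 'I_n is Some j then d j else 1).
split=> [i|i j /mutableP [i' ->] /mutableP [j' ->]]; first by case: insubP.
by rewrite !insub_top !agree_square_mx; have := sB i' j'; rewrite !mxE.
Qed.

End ClusterSeeds.

(** In characteristic zero the integers embed into [C], so independence over [C] implies
    independence over the integers. *)
Lemma mmap_int_eq0 (C : numDomainType) (F : fieldAlgType C) (m : nat) (x : 'I_m -> F) :
  alg_independent x -> forall p : {mpoly int[m]}, mmap (intmul 1) x p = 0 -> p = 0.
Proof.
move=> hx p hp; have : map_mpoly (intmul 1 : int -> C) p = 0.
  apply: hx; rewrite /eval_at -hp.
  have h1 := leq_maxl (msize p) (msize (map_mpoly (intmul 1 : int -> C) p)).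
  have h2 := leq_maxr (msize p) (msize (map_mpoly (intmul 1 : int -> C) p)).
  rewrite (mmapE _ h1) (mmapE _ h2); apply: eq_bigr => u _.
  by rewrite mcoeff_map_mpoly; congr (_ * _); apply: (rmorph_int (in_alg F)).
move=> h; apply/mpolyP => u; have := congr1 (mcoeff u) h.
by rewrite mcoeff_map_mpoly !mcoeff0 => /eqP; rewrite intr_eq0 => /eqP.
Qed.

Theorem proposition6p4p1 (K : realType)
  (R : idomainAlgType K[i]) (F : fieldAlgType K[i])
  (iota : {lrmorphism R -> F})
  (hfrac : is_fraction_field iota)
  (hnormal : integrally_closed_in iota)
  (hnoeth : noetherian R)
  (n m : nat) (le_nm : (n <= m)%N)
  (s : seed_data F m n) (hs : is_seed le_nm s)
  (y : 'I_m -> R)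
  (h1 : forall i : 'I_m, iota (y i) = vars s i)
  (h2 : forall k l : 'I_n, k != l ->
    coprime_elts (y (widen_ord le_nm k)) (y (widen_ord le_nm l)))
  (h3 : forall k : 'I_n, exists y' : R,
    iota y' = vars (mutate le_nm s k) (widen_ord le_nm k) /\
    coprime_elts y' (y (widen_ord le_nm k))) :
  forall z : F, in_cluster_algebra le_nm s z -> exists r : R, iota r = z.
Proof.
move=> z /(_ (pred_of (fun z => exists r : R, iota r = z))) hz.
apply/in_pred_of; apply: hz.
  split; first by apply/in_pred_of; exists 1; rewrite rmorph1.
    move=> a u v /in_pred_of [r <-] /in_pred_of [r' <-]; apply/in_pred_of.
    by exists (a *: r + r'); rewrite linearP.
  move=> u v /in_pred_of [r <-] /in_pred_of [r' <-]; apply/in_pred_of.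
  by exists (r * r'); rewrite rmorphM.
move=> {}z hz; apply/in_pred_of; case: hz => [[i _ ->]|[ks [l ->]]].
  by exists (y i).
case: hs => hfree _ hskew; have x_free := mmap_int_eq0 hfree.
have [d sB] := skew_square_mx hskew.
have hB := agree_square_mx le_nm s.
set B := square_mx s in sB hB.
rewrite (vars_foldl ks hB); set w := map _ ks; set u := run _ _ _ _.
have mw : all (@mutable m n) w.
  by apply/allP => i /mapP [j _ ->]; apply/mutableP; exists j.
have real_x i : realizes (vars s) (fun x => x i) (iota (y i)).
  by rewrite h1; apply: realizesX.
have real_z : realizes (vars s) (fun x => run B x w (widen_ord le_nm l)) u.
  by apply: (realizes_run x_free w (g := id)) => // i; rewrite -h1.
case: (excluded_middle_informative (exists r, iota r = u)) => // hnz; exfalso.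
have [P htP hP] := height1_conductor hfrac hnormal hnoeth hnz.
have in_P (a : R) : (exists r, u * iota a = iota r) -> a \in P.
  by move=> [r hr]; apply: hP; exists r; rewrite mulrC.
have [N [r hr]] := laurent_denominator
  (laurent_phenomenon_frozen (widen_ord le_nm l) sB mw)
  (fun x px => px) real_x real_z (fun x _ => erefl).
have [|_ /mutableP [k ->] ykP] := @prime_ideal_prod _ P _ (@mutable m n) y N.
  by apply: in_P; exists r; rewrite rmorphXn.
have [y' [hy' cop']] := h3 k.
pose k' := widen_ord le_nm k.
have mk : mutable n k' by apply/mutableP; exists k.
pose y1 i := if i == k' then y' else y i.
have real_y1 i : realizes (vars s) (fun x => mutX B k' x i) (iota (y1 i)).
  have -> : iota (y1 i) = mutX B k' (vars s) i.
    rewrite /y1; case: eqP => [->|/eqP/negPf ik]; last by rewrite /mutX ik.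
    by rewrite hy' (vars_mutate k hB).
  by apply: (realizes_mutX x_free (g := id)) => // j; rewrite -h1.
(* From the mutated seed the sequence k' :: w first returns to the initial one, so it produces the
   same element [u]. *)
have [||N' [r' hr']] := laurent_denominator
  (laurent_phenomenon_frozen (widen_ord le_nm l) (skew_mutB mk sB) (ks := k' :: w) _)
  (fun x px => pos_mutX B k' px) real_y1 real_z _.
- by rewrite /= mk.
- move=> x px /=; rewrite mutBK mutXK ?(skew_diag mk sB) ?gt_eqF //.
  exact: exch_poly_gt0.
have [|_ /mutableP [k2 ->]] := @prime_ideal_prod _ P _ (@mutable m n) y1 N'.
  by apply: in_P; exists r'; rewrite rmorphXn.
rewrite /y1 (inj_eq (@top_inj _ _ le_nm)); case: eqP => [_ y'P|/eqP k2k yk2P].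
  exact: (cop' P htP).
exact: (h2 k2 k k2k P htP).
Qed.
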